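(* Let $d\ge 1$ and let $\alpha_1,\ldots,\alpha_d$ be irrational numbers such that the additive group $H=\langle\alpha_1,\ldots,\alpha_d\rangle/\mathbb{Z}\subset\mathbb{R}/\mathbb{Z}$ generated by them modulo $\mathbb{Z}$ is isomorphic to $\mathbb{Z}^d$. Then the derived subgroup of $IET_H$ is simple and finitely generated.
   Context: $H$ denotes the subgroup of $\mathbb{R}/\mathbb{Z}$ generated by the images of $\alpha_1,\dots,\alpha_d$; it acts on $\mathbb{R}/\mathbb{Z}$ by translations. Let $W\subset[0,1]$ be the full preimage of $H$ under the quotient map $[0,1]\to\mathbb{R}/\mathbb{Z}$. Let $R_H$ be the set obtained from $[0,1]$ by replacing each $q\in W$ by two copies $q_{-0}$ and $q_{+0}$, where, according to the cyclic order of $\mathbb{R}/\mathbb{Z}$, $0_{-0}$ and $1_{-0}$ are both identified with the point $1$, and $0_{+0}$ and $1_{+0}$ are both identified with the point $0$ (so the endpoints are not doubled: they are the two copies of the single point $0=1$ of the circle). $R_H$ is linearly ordered in the natural way with $q_{-0}<q_{+0}$ for $q\in W\setminus\{0,1\}$, and it is equipped with the order topology; it is a Cantor set. The action of $H$ on $\mathbb{R}/\mathbb{Z}$ lifts to an action on $R_H$ by homeomorphisms by setting $h(q_{+0})=h(q)_{+0}$ and $h(q_{-0})=h(q)_{-0}$. $IET_H$ is the topological full group of the action of $H$ on $R_H$, i.e. the group of all homeomorphisms of $R_H$ that are locally equal to the action of elements of $H$. *)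

(* Defs.v *)
From HB Require Import structures.
From mathcomp Require Import all_boot all_order all_algebra ring_quotient.
From mathcomp Require Import all_classical all_reals topology.

Set Implicit Arguments.
Unset Strict Implicit.
Unset Printing Implicit Defensive.

Import Order.TTheory GRing.Theory Num.Theory.

Local Open Scope classical_set_scope.

Section Subgroups.
Local Open Scope group_scope.
Variable G : groupType.
Implicit Types A N : set G.

Definition is_subgroup A := A 1 /\ forall x y, A x -> A y -> A (x / y).

Definition generated_subgroup A : set G := smallest is_subgroup A.

Definition derived_subgroup A : set G :=
  generated_subgroup [set [~ x, y] | x in A & y in A].

Definition finitely_generated A :=
  exists2 S : set G, finite_set S & generated_subgroup S = A.

Definition normal_subgroup N A :=
  [/\ is_subgroup N, N `<=` A & forall x y, A x -> N y -> N (y ^ x)].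

Definition simple_group A :=
  A <> [set 1] /\ forall N, normal_subgroup N A -> N = [set 1] \/ N = A.

End Subgroups.

Section Homeomorphisms.
Variable T : topologicalType.

Record homeo := Homeo {
  homeo_fun :> T -> T;
  homeo_inv : T -> T;
  homeo_funK : cancel homeo_fun homeo_inv;
  homeo_invK : cancel homeo_inv homeo_fun;
  homeo_fun_continuous : continuous homeo_fun;
  homeo_inv_continuous : continuous homeo_inv
}.

HB.instance Definition _ := gen_eqMixin homeo.
HB.instance Definition _ := gen_choiceMixin homeo.

Lemma homeoP (f g : homeo) : f =1 g -> f = g.
Proof.
case: f g => [f f' fK f'K fc f'c] [g g' gK g'K gc g'c] /= /funext fg.
subst g; have : f' = g' by apply/funext => x; rewrite -{1}(g'K x) fK.
move=> fg; subst g'.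
by congr Homeo; exact: Prop_irrelevance.
Qed.

Definition homeo_id : homeo :=
  @Homeo id id (fun=> erefl) (fun=> erefl) (fun _ _ => id) (fun _ _ => id).

Definition homeo_sym (f : homeo) : homeo :=
  Homeo (homeo_invK f) (homeo_funK f)
    (homeo_inv_continuous (h := f)) (homeo_fun_continuous (h := f)).

Lemma comp_continuous (f g : T -> T) :
  continuous f -> continuous g -> continuous (f \o g).
Proof. by move=> fc gc x; apply: continuous_comp; [exact: gc|exact: fc]. Qed.

Definition homeo_comp (f g : homeo) : homeo :=
  Homeo (can_comp (homeo_funK f) (homeo_funK g))
    (can_comp (homeo_invK g) (homeo_invK f))
    (comp_continuous (homeo_fun_continuous (h := f))
       (homeo_fun_continuous (h := g)))
    (comp_continuous (homeo_inv_continuous (h := g))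
       (homeo_inv_continuous (h := f))).

Fact homeo_compA : associative homeo_comp.
Proof. by move=> f g h; exact: homeoP. Qed.
Fact homeo_comp1f : left_id homeo_id homeo_comp.
Proof. by move=> f; exact: homeoP. Qed.
Fact homeo_compf1 : right_id homeo_id homeo_comp.
Proof. by move=> f; exact: homeoP. Qed.
Fact homeo_compVf : left_inverse homeo_id homeo_sym homeo_comp.
Proof. by move=> f; apply: homeoP => x /=; rewrite homeo_funK. Qed.
Fact homeo_compfV : right_inverse homeo_id homeo_sym homeo_comp.
Proof. by move=> f; apply: homeoP => x /=; rewrite homeo_invK. Qed.

HB.instance Definition _ := isGroup.Build homeo
  homeo_compA homeo_comp1f homeo_compf1 homeo_compVf homeo_compfV.

Definition topological_full_group (K : Type) (H : set K) (act : K -> T -> T) :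
    set homeo :=
  [set f | forall x : T, exists2 h, H h & \forall y \near x, f y = act h y].

End Homeomorphisms.

Local Open Scope ring_scope.

Section Circle.
Variable R : realType.

Definition integers : zmodClosed R := (Num.int_num_subdef : {pred R}).

Definition circle : zmodType := Quotient.quot integers.

Definition to_circle (x : R) : circle := \pi_(Quotient.quot integers)%qT x.

Definition circle_subgroup (A : set circle) :=
  A 0 /\ forall x y, A x -> A y -> A (x - y).

Definition circle_generated (A : set circle) : set circle :=
  smallest circle_subgroup A.

Definition translation_group (d : nat) (alpha : 'I_d -> R) : set circle :=
  circle_generated [set to_circle (alpha i) | i in [set: 'I_d]].

(* The representatives of c in [0, 1[ and in ]0, 1] respectively. *)
Definition rep_right (c : circle) : R :=
  let x : R := repr (c : Quotient.quot integers) in x - (Num.floor x)%:~R.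
Definition rep_left (c : circle) : R :=
  let x : R := repr (c : Quotient.quot integers) in x - (Num.ceil x)%:~R + 1.

Lemma to_circleE (x y : R) : to_circle x = to_circle y <-> x - y \is a Num.int.
Proof.
rewrite [_ \is a _](Quotient.idealrBE integers x y).
by split => [xy|/eqP//]; apply/eqP.
Qed.

Lemma to_circleD (x y : R) : to_circle (x + y) = to_circle x + to_circle y.
Proof. exact: (raddfD \pi_(Quotient.quot integers)%qT). Qed.

Lemma to_circle_repr (c : circle) :
  to_circle (repr (c : Quotient.quot integers)) = c.
Proof. exact: reprK. Qed.

Lemma rep_right_itv (c : circle) : 0 <= rep_right c < 1.
Proof.
rewrite /rep_right; set x := repr _.
by rewrite subr_ge0 floor_le ltrBlDl -intrD1 floorD1_gt.
Qed.

Lemma rep_left_itv (c : circle) : 0 < rep_left c <= 1.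
Proof.
rewrite /rep_left; set x := repr _; have /andP[+ x1] := ceil_itv x.
by rewrite gerDr subr_le0 x1 intrB ltrBlDr addrAC subr_gt0 => ->.
Qed.

Lemma to_circle_rep_right (c : circle) : to_circle (rep_right c) = c.
Proof.
rewrite -[RHS]to_circle_repr; apply/to_circleE.
by rewrite /rep_right addrC addKr rpredN intr_int.
Qed.

Lemma to_circle_rep_left (c : circle) : to_circle (rep_left c) = c.
Proof.
rewrite -[RHS]to_circle_repr; apply/to_circleE.
by rewrite /rep_left addrAC [X in X - _]addrC addrK rpredD ?rpredN ?intr_int ?rpred1.
Qed.

End Circle.

Section SplitInterval.
Variables (R : realType) (H : set (circle R)).

(* A doubled point q of the preimage of H in [0, 1] is encoded by
   q_{-0} = (q, false) and q_{+0} = (q, true), and a point x which is not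
   doubled by (x, false). Of the copies of the endpoints, only
   0_{+0} (= 1_{+0}), the point 0, and 1_{-0} (= 0_{-0}), the point 1, are
   kept. With false < true, the natural order is the lexicographic one. *)
Definition split_pred (p : R *l bool) : bool :=
  [&& 0 <= p.1 <= 1,
      `[< H (to_circle p.1) >] || ~~ p.2,
      (p.1 == 0) ==> p.2
    & (p.1 == 1) ==> ~~ p.2].

Definition split_interval_order := {p : R *l bool | split_pred p}.

HB.instance Definition _ := SubChoice.on split_interval_order.
HB.instance Definition _ :=
  [SubChoice_isSubOrder of split_interval_order by <: with Order.default_display].

Definition split_interval : topologicalType :=
  order_topology split_interval_order.

(* The copy c_{+0} (s = true) or c_{-0} (s = false) of a point c of the circle;
   s is irrelevant if c is not in H. *)
Definition copy_pair (c : circle R) (s : bool) : R *l bool :=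
  if s && `[< H c >] then (rep_right c, true) else (rep_left c, false).

Lemma copy_subproof c s : split_pred (copy_pair c s).
Proof.
rewrite /copy_pair; case: ifP => [/andP[_ /asboolP Hc]|_];
  rewrite /split_pred /= ?orbT ?implybT ?implybF ?andbT.
- have [r0 r1] := andP (rep_right_itv c).
  by rewrite r0 (ltW r1) (lt_eqF r1) to_circle_rep_right /= asboolT.
- have [l0 l1] := andP (rep_left_itv c).
  by rewrite l1 (ltW l0) (gt_eqF l0).
Qed.

Definition split_copy (c : circle R) (s : bool) : split_interval :=
  exist _ (copy_pair c s) (copy_subproof c s) : split_interval_order.

Definition translate (h : circle R) (p : split_interval) : split_interval :=
  let p' := val (p : split_interval_order) in
  split_copy (h + to_circle p'.1) p'.2.

Definition IET : set (homeo split_interval) :=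
  topological_full_group H translate.

End SplitInterval.

Arguments IET {R} H.

(* Main.v *)
Require Import Defs.
From mathcomp Require Import all_boot all_order all_algebra.
From mathcomp Require Import all_classical all_reals topology lra.

(** Let [L] be the group of the real numbers whose class modulo 1 belongs to
  [H]. It contains 1, it is finitely generated, and it is dense because it
  contains an irrational number. The copies [x_{+0}] of the points [x] of
  [[0, 1)] are dense in [R_H], and an element of [IET_H] acts on them as an
  interval exchange whose breakpoints belong to [L]; finiteness of the number
  of breakpoints is the compactness of [R_H] ([IET_breakpoints]). Conversely, the
  exchanges of two adjacent intervals with endpoints in [L], called rotations
  here, come from [IET_H] ([IET_rotation]). The record [iet_group] lists what is
  used of this action, and everything else takes place on the real line.

  The central objects are the cycles [cyc x y z l], which permute cyclically
  three disjoint arcs [[x, x + l)], [[y, y + l)], [[z, z + l)] by translations,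
  and the group [alt] that they generate. A cycle is the product of its
  restrictions to subarcs ([cycD]), so that only short arcs matter, and short
  arcs leave room for further disjoint arcs ([room]): cycles can then be handled
  like 3-cycles in a finite alternating group.

  The derived subgroup is [alt] ([derived_alt]). A cycle is a commutator of
  exchanges of arcs. For the converse, [alt] is normal, since the arcs of a cycle
  can be cut at the breakpoints of the conjugating element. Sorting the pieces
  shows that [IET_H] is generated by rotations ([rotations_generate]), hence by
  short ones ([rotation_short]), and two short rotations commute modulo [alt]:
  conjugation by a cycle makes their supports disjoint.

  Simplicity ([alt_simple]): if [N] is normal in [alt] and contains [f <> 1], then
  [f] moves some arc off itself, so that [N] contains the commutators of the
  elements of [alt] supported on that arc. As a 3-cycle on five points is a
  commutator of 3-cycles, [N] contains a cycle with arcs of any given short length,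
  then by conjugation all the cycles with arcs of that length, and these generate.

  Finite generation ([alt_sub_zones]): divide the main part of [[0, 1)] into four
  zones of length [N]. Let [P] contain, for each [s] in a finite set [S] of short
  generators of [L], elements that shift the points of one of the first three
  zones by [s], and the cycle of arcs of length [s] at the beginning of these
  zones, as well as two cycles that permute whole zones. The lengths [a] for
  which the cycle of arcs of length [a] at the beginning of the zones is in [P]
  are stable under [a -> a + s] and [a -> a - s], because that cycle is the product
  of the one of length [s] and of a shift of the one of length [a - s]. As [S]
  generates [L], a walk with short steps reaches all the lengths
  ([zone_cycles_start]). A similar walk reaches all the positions inside the
  zones ([zone_cycles]), and the remaining cycles are obtained by conjugation. *)

Set Implicit Arguments.
Unset Strict Implicit.
Unset Printing Implicit Defensive.

Import Order.TTheory GRing.Theory Num.Theory.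

Local Open Scope classical_set_scope.
Local Open Scope ring_scope.

(** * Subgroups *)

Section GroupFacts.
Local Open Scope group_scope.
Variable G : groupType.
Implicit Types (A B : set G) (x y : G).

Lemma subgroup1 A : is_subgroup A -> A 1.
Proof. by case. Qed.

Lemma subgroupV A x : is_subgroup A -> A x -> A x^-1.
Proof. by case=> A1 AF Ax; rewrite -div1g; exact: AF. Qed.

Lemma subgroupM A x y : is_subgroup A -> A x -> A y -> A (x * y).
Proof. by move=> sA Ax Ay; rewrite -[y]invgK; apply: sA.2 => //; exact: subgroupV. Qed.

Lemma subgroupJ A x y : is_subgroup A -> A x -> A y -> A (x ^ y).
Proof.
by move=> sA Ax Ay; rewrite conjgE; do !apply: subgroupM => //; exact: subgroupV.
Qed.

Lemma generated_subgroupP A : is_subgroup (generated_subgroup A).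
Proof.
split=> [B [[]]//|x y gx gy B sB].
by apply: sB.1.2; [exact: gx|exact: gy].
Qed.

Lemma sub_generated A : A `<=` generated_subgroup A.
Proof. by move=> x Ax B [_]; apply. Qed.

Lemma generated_sub A B : is_subgroup B -> A `<=` B -> generated_subgroup A `<=` B.
Proof. by move=> sB AB x; apply. Qed.

(** The elements that commute modulo [N] with a given one form a subgroup. This
  is used once in each variable. *)
Lemma generated_commg A N : is_subgroup N ->
  (forall x y, generated_subgroup A y -> N x -> N (x ^ y)) ->
  (forall x y, A x -> A y -> N [~ x, y]) ->
  forall x y, generated_subgroup A x -> generated_subgroup A y -> N [~ x, y].
Proof.
move=> sN nN cN; set K := generated_subgroup A.
have sK : is_subgroup K := generated_subgroupP A.
have centralizer x : K x -> is_subgroup (K `&` [set y | N [~ y, x]]).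
  move=> Kx; split; first by split; [exact: sK.1|rewrite /= comm1g; exact: sN.1].
  move=> y z [Ky /= Ny] [Kz /= Nz]; split => /=; first exact: sK.2.
  have -> : [~ y / z, x] = ([~ y, x] * ([~ z, x])^-1) ^ z^-1.
    by rewrite !commgEl !conjgE !invgM !invgK !mulgA !mulgK.
  by apply: nN (subgroupV sK Kz) _; exact: sN.2.
move=> x y Kx Ky.
suff /(generated_sub (centralizer y Ky))/(_ _ Kx)[]// :
  A `<=` K `&` [set z | N [~ z, y]] by [].
move=> {Kx}x Ax; have Kx := sub_generated Ax; split => //=.
suff /(generated_sub (centralizer x Kx))/(_ _ Ky)[_ /= Nyx] :
    A `<=` K `&` [set z | N [~ z, x]].
  by rewrite -invgR; exact: subgroupV.
by move=> z Az; split; [exact: sub_generated|exact: cN].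
Qed.

End GroupFacts.

(** * Groups of interval exchanges *)

(** The exchange of [[x, x + a)] and [[x + a, x + a + b)], as a rotation of their
  union. *)
Definition rotation_fun (R : realType) (x a b p : R) : R :=
  if x <= p < x + a then p + b
  else if x + a <= p < x + a + b then p - a else p.

(** A group [iets] of interval exchanges of [[0, 1)] with endpoints in a dense
  subgroup [lengths] of the line, which contains all the rotations. The group is
  given by a faithful action [ev] on [[0, 1)] rather than as a group of bijections,
  so as to apply to homeomorphisms of the split interval; [ev] is unspecified
  outside [[0, 1)] and on elements that are not in [iets]. *)
Record iet_group (R : realType) := IETGroup {
  carrier :> groupType;
  iets : set carrier;
  lengths : set R;
  ev : carrier -> R -> R;
  iets_subgroup : is_subgroup iets;
  lengths1 : lengths 1;
  lengthsB : forall a b, lengths a -> lengths b -> lengths (a - b);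
  lengths_dense : forall e, 0 < e -> exists2 a, lengths a & 0 < a < e;
  ev1 : forall p, 0 <= p < 1 -> ev 1%g p = p;
  evM : forall f g p, iets f -> iets g -> 0 <= p < 1 ->
    ev (f * g)%g p = ev f (ev g p);
  ev_unit : forall f p, iets f -> 0 <= p < 1 -> 0 <= ev f p < 1;
  ev_lens : forall f p, iets f -> 0 <= p < 1 -> lengths p -> lengths (ev f p);
  ev_inj : forall f g, iets f -> iets g ->
    (forall p, 0 <= p < 1 -> ev f p = ev g p) -> f = g;
  rotation_ex : forall x a b, lengths x -> lengths a -> lengths b ->
    0 <= x -> 0 <= a -> 0 <= b -> x + a + b <= 1 ->
    exists2 r, iets r & forall p, 0 <= p < 1 -> ev r p = rotation_fun x a b p;
  breakpoints : forall f, iets f -> exists2 B : seq R,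
    forall b, b \in B -> lengths b &
    forall a b, lengths a -> lengths b -> 0 <= a -> a < b -> b <= 1 ->
      (forall t, t \in B -> ~~ (a < t < b)) ->
      exists c, forall p, a <= p < b -> ev f p = p + c
}.

Section Lengths.
Variables (R : realType) (X : iet_group R).
Local Notation L := (lengths X).

Lemma lengths0 : L 0.
Proof. by rewrite -(subrr 1); apply: lengthsB; exact: lengths1. Qed.

Lemma lengthsN a : L a -> L (- a).
Proof. by rewrite -[- a]add0r; apply: lengthsB lengths0. Qed.

Lemma lengthsD a b : L a -> L b -> L (a + b).
Proof. by move=> La Lb; rewrite -[b]opprK; apply: lengthsB => //; exact: lengthsN. Qed.

Lemma lengthsMn a n : L a -> L (n%:R * a).
Proof.
move=> La; elim: n => [|n IHn]; first by rewrite mul0r; exact: lengths0.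
by rewrite -natr1 mulrDl mul1r; exact: lengthsD.
Qed.

(** Induction for properties of intervals that are additive under
  concatenation: cut the interval at the points of [B] that it contains. *)
Lemma cut_ind (P : R -> R -> Prop) (lo hi : R) (B : seq R) :
  (forall b, b \in B -> L b) ->
  (forall a c b, L a -> L c -> L b -> lo <= a -> b <= hi -> a < c -> c < b ->
     P a c -> P c b -> P a b) ->
  (forall a b, L a -> L b -> lo <= a -> a < b -> b <= hi ->
     (forall t, t \in B -> ~~ (a < t < b)) -> P a b) ->
  forall a b, L a -> L b -> lo <= a -> a < b -> b <= hi -> P a b.
Proof.
move=> + PD; elim: B => [|t B IHB] LB PB a b La Lb loa ab bhi; first exact: PB.
apply: IHB => // [u uB|{}a {}b {}La {}Lb {}loa {}ab {}bhi Bab].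
  by apply: LB; rewrite inE uB orbT.
have Lt : L t by apply: LB; rewrite inE eqxx.
have noB a' b' : ~~ (a' < t < b') -> a <= a' -> b' <= b ->
    forall u, u \in t :: B -> ~~ (a' < u < b').
  by move=> nt aa bb u; rewrite inE => /orP[/eqP->//|/Bab]; lra.
have [/andP[at_ tb]|ntab] := boolP (a < t < b); last by apply: PB => //; exact: noB.
by apply: (PD a t b) => //; apply: PB => //; try lra; apply: noB => //; lra.
Qed.

(** The same principle, with cuts at multiples of a short length, which exists
  by density. *)
Lemma short_ind (P : R -> R -> Prop) (lo hi e : R) : 0 < e ->
  (forall a c b, L a -> L c -> L b -> lo <= a -> b <= hi -> a < c -> c < b ->
     P a c -> P c b -> P a b) ->
  (forall a b, L a -> L b -> lo <= a -> a < b -> b <= hi -> b - a <= e -> P a b) ->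
  forall a b, L a -> L b -> lo <= a -> a < b -> b <= hi -> P a b.
Proof.
move=> e0 PD Pe; have [s Ls /andP[s0 se]] := lengths_dense X e0.
suff IH n a b : L a -> L b -> lo <= a -> a < b -> b <= hi ->
    b - a <= n%:R * s -> P a b.
  move=> a b La Lb loa ab bhi; apply: (IH (Num.truncn ((b - a) / s)).+1) => //.
  by rewrite -ler_pdivrMr//; apply/ltW/truncnS_gt.
elim: n a b => [|n IHn] a b La Lb loa ab bhi; first by rewrite mul0r; lra.
rewrite -natr1 mulrDl mul1r => h.
have [bas|sba] := lerP (b - a) s; first by apply: Pe => //; lra.
have Las := lengthsD La Ls.
apply: (PD a (a + s) b) => //; try lra; first by apply: Pe => //; lra.
by apply: IHn => //; lra.
Qed.

(** Start at [p] and push an arc of length [w] to the right end of any of the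
  given arcs that it meets: each of them is met at most once and costs less than
  [2w]. *)
Lemma room (w : R) (xs : seq R) (p : R) : 0 <= w -> L w -> L p ->
  (forall x, x \in xs -> L x) ->
  exists z, [/\ L z, p <= z <= p + (2 * size xs)%:R * w &
                forall x, x \in xs -> (x + w <= z) || (z + w <= x)].
Proof.
move=> w0 Lw; move: {2}(size xs) (erefl (size xs)) => n.
elim: n xs p => [|n IHn] xs p szs Lp Lxs.
  exists p; split => // [|x]; first by rewrite szs muln0 mul0r; lra.
  by rewrite (size0nil szs).
have [/allP clear|] := boolP (all (fun x => (x + w <= p) || (p + w <= x)) xs).
  exists p; split => //; have := mulr_ge0 (ler0n R (2 * size xs)%N) w0; lra.
rewrite -has_predC => /hasP[x xxs /= hx].
have Lx := Lxs x xxs.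
have [||y yr|z [Lz pz far]] := IHn (rem x xs) (x + w).
- by rewrite size_rem // szs.
- exact: lengthsD.
- by apply: Lxs; exact: mem_rem yr.
exists z; split => //.
  move: pz; rewrite size_rem // szs /= mulnS natrD mulrDl.
  by have := mulr_ge0 (ler0n R (2 * n)%N) w0; lra.
move=> y; have [->|yx] := eqVneq y x; first by move: pz; lra.
by move=> yxs; apply: far; rewrite rem_mem.
Qed.

(** The steps of a walk between two points of [[0, M]] can be reordered so that
  it never leaves [[0, M]]: as long as there are steps of both signs, go up close
  to 0 and down elsewhere; steps of a single sign stay between the two ends. *)
Lemma walk (C : R -> Prop) (S ws : seq R) (c M y : R) : 2 * c <= M ->
  (forall w, w \in ws -> (w \in S) || (- w \in S)) ->
  (forall s, s \in S -> `|s| <= c) ->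
  (forall x w : R, 0 <= x <= M -> 0 <= x + w <= M -> (w \in S) || (- w \in S) ->
    C x -> C (x + w)) ->
  0 <= y <= M -> 0 <= y + \sum_(w <- ws) w <= M -> C y -> C (y + \sum_(w <- ws) w).
Proof.
move=> cM + Sc step; move: {2}(size ws) (erefl (size ws)) => n.
elim: n ws y => [|n IHn] ws y szws wsS yM yws Cy.
  by move: yws; rewrite (size0nil szws) big_nil addr0.
have sumE w : w \in ws -> \sum_(j <- ws) j = w + \sum_(j <- rem w ws) j.
  by move=> wws; rewrite (big_rem w).
suff [w wws yw] : exists2 w, w \in ws & 0 <= y + w <= M.
  move: (yws); rewrite (sumE w) // addrA => ywsE.
  apply: IHn => //; first by rewrite size_rem // szws.
    by move=> v /mem_rem; exact: wsS.
  by apply: step => //; exact: wsS.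
have wc w : w \in ws -> - c <= w <= c.
  by move=> /wsS/orP[] /Sc; rewrite ler_norml //; lra.
have [/hasP[w wws /= w0]|/hasPn pos] := boolP (has (fun w : R => w < 0) ws);
have [/hasP[v vws /= v0]|/hasPn neg] := boolP (has (fun w : R => 0 < w) ws).
- have [yl|yl] := lerP y c; first by exists v => //; have := wc v vws; lra.
  by exists w => //; have := wc w wws; lra.
- exists w => //; rewrite (sumE w) // in yws.
  have : \sum_(j <- rem w ws) j <= 0.
    by rewrite big_seq; apply: sumr_le0 => i /mem_rem/neg; rewrite -leNgt.
  by lra.
- exists v => //; rewrite (sumE v) // in yws.
  have : 0 <= \sum_(j <- rem v ws) j.
    by rewrite big_seq; apply: sumr_ge0 => i /mem_rem/pos; rewrite -leNgt.
  by lra.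
- case: ws szws {wsS IHn yws sumE} wc pos neg => // w ws _ _ pos neg.
  have wws : w \in w :: ws by rewrite inE eqxx.
  by exists w => //; have := pos w wws; have := neg w wws; lra.
Qed.

End Lengths.

#[local] Hint Resolve lengths0 lengths1 lengthsN lengthsD lengthsMn : lengths.

(** * Arcs, exchanges and cycles *)

#[local] Hint Resolve lengthsB : lengths.

Section Cycles.
Variables (R : realType) (X : iet_group R).
Local Notation L := (lengths X).
Local Notation E := (@iets R X).
Implicit Types (f g c : X) (x y z l p : R).

Definition in_arc x l p := x <= p < x + l.
Definition apart l x y := (x + l <= y) || (y + l <= x).
Definition arc l x := [/\ L x, 0 <= x & x + l <= 1].
Definition moves g x y l := forall o, 0 <= o < l -> ev g (x + o) = y + o.
Definition supported g (A : R -> bool) :=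
  forall p, 0 <= p < 1 -> ~~ A p -> ev g p = p.

Definition triad x y z l :=
  [/\ L l /\ 0 <= l, [/\ arc l x, arc l y & arc l z]
    & [/\ apart l x y, apart l y z & apart l x z]].

Definition is_swap s x y l :=
  [/\ moves s x y l, moves s y x l &
      supported s (fun p => in_arc x l p || in_arc y l p)].

Definition is_cycle c x y z l :=
  [/\ moves c x y l, moves c y z l, moves c z x l &
      supported c (fun p => [|| in_arc x l p, in_arc y l p | in_arc z l p])].

Lemma iets1 : E 1%g. Proof. exact: subgroup1 (iets_subgroup X). Qed.
Lemma ietsM f g : E f -> E g -> E (f * g)%g.
Proof. exact: subgroupM (iets_subgroup X). Qed.
Lemma ietsV f : E f -> E f^-1%g.
Proof. exact: subgroupV (iets_subgroup X). Qed.
Lemma ietsJ f g : E f -> E g -> E (f ^ g)%g.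
Proof. exact: subgroupJ (iets_subgroup X). Qed.
Hint Resolve iets1 ietsM ietsV ietsJ : core.

Lemma evK g p : E g -> 0 <= p < 1 -> ev g^-1%g (ev g p) = p.
Proof. by move=> Eg p01; rewrite -evM ?mulVg ?ev1 //; exact: ietsV. Qed.

Lemma evVK g p : E g -> 0 <= p < 1 -> ev g (ev g^-1%g p) = p.
Proof. by move=> Eg p01; rewrite -evM ?mulgV ?ev1 //; exact: ietsV. Qed.

Lemma ev_injective g p q : E g -> 0 <= p < 1 -> 0 <= q < 1 ->
  ev g p = ev g q -> p = q.
Proof. by move=> Eg p01 q01 /(congr1 (ev g^-1%g)); rewrite !evK. Qed.

Lemma movesS g x y l o l' : moves g x y l -> 0 <= o -> o + l' <= l ->
  moves g (x + o) (y + o) l'.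
Proof. by move=> gxy o0 ol u ul; rewrite -!addrA gxy //; lra. Qed.

Lemma supportedS g (A B : R -> bool) : supported g A ->
  (forall p, 0 <= p < 1 -> A p -> B p) -> supported g B.
Proof. by move=> gA AB p p01 Bp; apply: gA => //; apply: contra Bp; exact: AB. Qed.

Lemma moves_id g A x l : supported g A -> 0 <= x -> x + l <= 1 ->
  (forall p, x <= p < x + l -> ~~ A p) -> moves g x x l.
Proof. by move=> gA x0 x1 xA o ol; apply: gA; [|apply: xA]; lra. Qed.

Lemma movesV g x y l : E g -> moves g x y l -> 0 <= x -> x + l <= 1 ->
  moves g^-1%g y x l.
Proof. by move=> Eg gxy x0 x1 o ol; rewrite -gxy // evK //; lra. Qed.

Lemma movesM f g x y z l : E f -> E g -> moves g x y l -> moves f y z l ->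
  0 <= x -> x + l <= 1 -> moves (f * g)%g x z l.
Proof. by move=> Ef Eg gxy fyz x0 x1 o ol; rewrite evM ?gxy ?fyz //; lra. Qed.

Lemma moves_arc g x y l : E g -> arc l x -> 0 < l -> moves g x y l -> arc l y.
Proof.
move=> Eg [Lx x0 x1] l0 gxy.
have gx : ev g x = y by rewrite -[x]addr0 gxy ?addr0 //; lra.
have [y0 y1] : 0 <= y /\ y < 1 by apply/andP; rewrite -gx ev_unit //; lra.
split=> //; first by rewrite -gx; apply: ev_lens => //; lra.
rewrite leNgt; apply/negP => yl.
have := @ev_unit _ _ g (x + (1 - y)) Eg; rewrite gxy; lra.
Qed.

(** Images of disjoint arcs are disjoint: a common point of the images would be
  the image of a common point. *)
Lemma moves_apart g x y x' y' l : E g -> arc l x -> arc l y ->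
  moves g x x' l -> moves g y y' l -> 0 < l -> apart l x y -> apart l x' y'.
Proof.
wlog xy' : x y x' y' / x' <= y' => [hw|] Eg ax ay gx gy l0 xy.
  case: (lerP x' y') => [?|/ltW ?]; first exact: (hw x y).
  by rewrite /apart orbC; apply: (hw y x) => //; rewrite /apart orbC.
case: ax ay xy => [_ x0 x1] [_ y0 y1]; rewrite !/apart => xy.
have [//|/negP nxy] := boolP (x' + l <= y').
suff : x + (y' - x') = y + 0 by lra.
by apply: (ev_injective Eg); rewrite ?gx ?gy; lra.
Qed.

Lemma supportedM f g A : E f -> E g -> supported f A -> supported g A ->
  supported (f * g)%g A.
Proof. by move=> Ef Eg fA gA p p01 Ap; rewrite evM // gA // fA. Qed.

Lemma supportedV f A : E f -> supported f A -> supported f^-1%g A.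
Proof. by move=> Ef fA p p01 Ap; rewrite -{1}(fA p) ?evK. Qed.

Lemma supportedJ f g x y l : E f -> E g -> supported f (in_arc x l) ->
  moves g y x l -> 0 <= y -> y + l <= 1 -> supported (f ^ g)%g (in_arc y l).
Proof.
move=> Ef Eg fx gyx y0 y1 p p01 py; have gp := ev_unit Eg p01.
rewrite conjgE !evM //; [|exact: ietsV|exact: ietsM].
rewrite fx ?evK //; apply: contra py; rewrite /in_arc => h.
have : p = y + (ev g p - x).
  by apply: (ev_injective Eg) => //; [lra|rewrite gyx ?subrKC //; lra].
by lra.
Qed.

Lemma supported_commute f g A B : E f -> E g -> supported f A -> supported g B ->
  (forall p, 0 <= p < 1 -> A p -> ~~ B p) -> commute f g.
Proof.
move=> Ef Eg fA gB AB; apply: ev_inj; [exact: ietsM|exact: ietsM|move=> p p01].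
have stable h C : E h -> supported h C -> C p -> ~~ C (ev h p) -> False.
  move=> Eh hC Cp Chp; have := hC _ (ev_unit Eh p01) Chp.
  by move/(ev_injective Eh (ev_unit Eh p01) p01) => e; rewrite e Cp in Chp.
rewrite !evM //; have [Ap|nAp] := boolP (A p).
  have nBp := AB p p01 Ap; rewrite (gB p) //.
  have [Afp|/(stable _ _ Ef fA Ap)//] := boolP (A (ev f p)).
  by rewrite gB //; [exact: ev_unit|exact: AB (ev_unit Ef p01) Afp].
rewrite (fA p) //; have [Bp|nBp] := boolP (B p); last by rewrite (gB p) // fA.
have [Bgp|/(stable _ _ Eg gB Bp)//] := boolP (B (ev g p)).
rewrite fA //; first exact: ev_unit.
by apply: contraL Bgp => Agp; exact: AB (ev_unit Eg p01) Agp.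
Qed.

Lemma is_swapC s x y l : is_swap s x y l -> is_swap s y x l.
Proof.
case=> sxy syx sS; split=> //; apply: supportedS sS _ => p _ /=.
by rewrite orbC.
Qed.

Lemma swap_ex_lt x y l : L l -> 0 <= l -> arc l x -> arc l y -> x + l <= y ->
  exists2 s, E s & is_swap s x y l.
Proof.
move=> Ll l0 ax ay xy.
case: ax ay => [Lx x0 x1] [Ly y0 y1].
have [|||||||r Er rE] := @rotation_ex _ X x l (y - x); auto with lengths; try lra.
have [|||||||t Et tE] := @rotation_ex _ X x (y - x - l) l; auto with lengths; try lra.
exists (t * r)%g; first exact: ietsM.
have evE p : 0 <= p < 1 -> ev (t * r)%g p =
    if x <= p < x + l then p + (y - x) else
    if y <= p < y + l then p - (y - x) else p.
  move=> p01; have := ev_unit Er p01; rewrite evM // rE // /rotation_fun.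
  by do 2?[case: ifPn => ?] => rp; rewrite tE // /rotation_fun;
    do 4?[case: ifPn => ?]; lra.
split=> [o ol|o ol|p p01]; rewrite /in_arc evE; try lra; repeat (case: ifPn => ?); lra.
Qed.

Lemma swap_ex x y l : L l -> 0 <= l -> arc l x -> arc l y -> apart l x y ->
  exists2 s, E s & is_swap s x y l.
Proof.
move=> Ll l0 ax ay /orP[xy|yx]; first exact: swap_ex_lt.
by have [s Es sw] := swap_ex_lt Ll l0 ay ax yx; exists s => //; exact: is_swapC.
Qed.

Lemma swap_swap_cycle s t x y z l : E s -> E t -> triad x y z l ->
  is_swap s x y l -> is_swap t y z l -> is_cycle (s * t)%g x y z l.
Proof.
rewrite /triad /arc /apart => Es Et.
move=> [[Ll l0] [[Lx x0 x1] [Ly y0 y1] [Lz z0 z1]] [xy yz xz]].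
move=> [sxy syx sS] [tyz tzy tS]; rewrite /in_arc in sS tS.
split=> [o ol|o ol|o ol|p p01]; rewrite ?evM /in_arc //; try lra.
- by rewrite tS ?sxy //; lra.
- by rewrite tyz // sS //; lra.
- by rewrite tzy // syx.
- by move=> pA; rewrite tS ?sS //; lra.
Qed.

(** The cycle is determined by its action, see [is_cycle_eq]; the choice of a
  witness only serves to name it. *)
Definition cyc x y z l : X :=
  xget 1%g [set c : X | E c /\ is_cycle c x y z l].

Lemma cycP x y z l : triad x y z l -> E (cyc x y z l) /\ is_cycle (cyc x y z l) x y z l.
Proof.
move=> tr; case: (tr) => [[Ll l0] [ax ay az] [xy yz xz]].
have [s Es sP] := swap_ex Ll l0 ax ay xy.
have [t Et tP] := swap_ex Ll l0 ay az yz.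
have := @xgetPex _ 1%g [set c : X | E c /\ is_cycle c x y z l]; apply.
by exists (s * t)%g; split; [exact: ietsM|exact: swap_swap_cycle].
Qed.

Lemma is_cycle_eq c c' x y z l : E c -> E c' ->
  is_cycle c x y z l -> is_cycle c' x y z l -> c = c'.
Proof.
move=> Ec Ec' [c1 c2 c3 cS] [d1 d2 d3 dS]; apply: ev_inj => // p p01.
have [px|npx] := boolP (in_arc x l p).
  by rewrite /in_arc in px; rewrite -(subrKC x p) c1 ?d1 //; lra.
have [py|npy] := boolP (in_arc y l p).
  by rewrite /in_arc in py; rewrite -(subrKC y p) c2 ?d2 //; lra.
have [pz|npz] := boolP (in_arc z l p).
  by rewrite /in_arc in pz; rewrite -(subrKC z p) c3 ?d3 //; lra.
by rewrite cS ?dS //; rewrite !negb_or npx npy npz.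
Qed.

Lemma cyc_eq c x y z l : E c -> is_cycle c x y z l -> cyc x y z l = c.
Proof.
move=> Ec cP; have [] : [set c : X | E c /\ is_cycle c x y z l] (cyc x y z l).
  by apply: xgetPex; exists c.
by move=> Ec' c'P; exact: is_cycle_eq c'P cP.
Qed.

Lemma is_cycle_rot c x y z l : is_cycle c x y z l -> is_cycle c y z x l.
Proof.
case=> c1 c2 c3 cS; split=> //; apply: supportedS cS _ => p _ /=.
by rewrite orbC orbA.
Qed.

Lemma is_cycleV c x y z l : E c -> triad x y z l -> is_cycle c x y z l ->
  is_cycle c^-1%g x z y l.
Proof.
move=> Ec [_ [[_ ? ?] [_ ? ?] [_ ? ?]] _] [c1 c2 c3 cS].
split; try exact: movesV; apply: supportedV => //; apply: supportedS cS _ => p _ /=.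
by rewrite [X in _ || X]orbC.
Qed.

Lemma is_cycleJ c g x y z x' y' z' l : E c -> E g -> triad x y z l ->
  triad x' y' z' l -> is_cycle c x y z l ->
  moves g x' x l -> moves g y' y l -> moves g z' z l ->
  is_cycle (c ^ g)%g x' y' z' l.
Proof.
move=> Ec Eg [_ [[_ ? ?] [_ ? ?] [_ ? ?]] _] [_ [[_ ? ?] [_ ? ?] [_ ? ?]] _].
move=> [c1 c2 c3 cS] gx gy gz.
have gV := movesV Eg; rewrite conjgE; split.
- by apply: (movesM (y := y)) => //; [exact: ietsV|exact: ietsM|
    apply: (movesM (y := x))|apply: gV].
- by apply: (movesM (y := z)) => //; [exact: ietsV|exact: ietsM|
    apply: (movesM (y := y))|apply: gV].
- by apply: (movesM (y := x)) => //; [exact: ietsV|exact: ietsM|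
    apply: (movesM (y := z))|apply: gV].
move=> p p01 pA; rewrite !evM //; [|exact: ietsV|exact: ietsM].
have gp := ev_unit Eg p01; rewrite cS ?evK //; apply: contra pA.
have back w w' : moves g w' w l -> 0 <= w' -> w' + l <= 1 ->
    in_arc w l (ev g p) -> in_arc w' l p.
  rewrite /in_arc => gw w0 w1 wp; rewrite -(evK Eg p01) -(subrKC w (ev g p)).
  by rewrite (gV _ _ _ gw) //; lra.
by move=> /or3P[] h; apply/or3P; [apply: Or31|apply: Or32|apply: Or33];
  apply: back h.
Qed.

End Cycles.

(** * Calculus of cycles *)

#[local] Hint Resolve iets1 ietsM ietsV ietsJ : core.

Section CycleCalculus.
Variables (R : realType) (X : iet_group R).
Local Notation L := (lengths X).
Local Notation E := (@iets R X).
Local Notation triad := (triad X).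
Local Notation cyc := (cyc X).
Implicit Types (f g : X) (x y z l p : R).

Lemma apartC l x y : apart l x y = apart l y x.
Proof. by rewrite /apart orbC. Qed.

Lemma triad_rot x y z l : triad x y z l -> triad y z x l.
Proof. by case=> ? [? ? ?] [? ? ?]; split=> //; split; rewrite // apartC. Qed.

Lemma triad_flip x y z l : triad x y z l -> triad x z y l.
Proof. by case=> ? [? ? ?] [? ? ?]; split=> //; split; rewrite // apartC. Qed.

Lemma triadS x y z l o l' : triad x y z l -> L o -> L l' -> 0 <= o -> 0 <= l' ->
  o + l' <= l -> triad (x + o) (y + o) (z + o) l'.
Proof.
move=> [[Ll l0] [[Lx x0 x1] [Ly y0 y1] [Lz z0 z1]] [xy yz xz]] Lo Ll' o0 l'0 ol.
split=> //; split; try (by split; [exact: lengthsD|lra|lra]).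
- by move: xy; rewrite /apart; lra.
- by move: yz; rewrite /apart; lra.
- by move: xz; rewrite /apart; lra.
Qed.

Lemma triad_sub x y z l l' : triad x y z l -> L l' -> 0 <= l' -> l' <= l ->
  triad x y z l'.
Proof.
move=> tr Ll' l'0 ll; rewrite -(addr0 x) -(addr0 y) -(addr0 z).
by apply: triadS tr _ _ _ _ _ => //; [exact: lengths0|lra].
Qed.

Lemma cycE x y z l : triad x y z l -> E (cyc x y z l).
Proof. by case/cycP. Qed.
Hint Resolve cycE : core.

Lemma cyc_cycle x y z l : triad x y z l -> is_cycle (cyc x y z l) x y z l.
Proof. by case/cycP. Qed.

Lemma cyc_moves x y z l : triad x y z l -> moves (cyc x y z l) x y l.
Proof. by case/cyc_cycle. Qed.

Lemma cyc_rot x y z l : triad x y z l -> cyc x y z l = cyc y z x l.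
Proof.
by move=> tr; apply/esym/cyc_eq; [exact: cycE|exact/is_cycle_rot/cyc_cycle].
Qed.

Lemma cycV x y z l : triad x y z l -> (cyc x y z l)^-1%g = cyc x z y l.
Proof.
move=> tr; apply/esym/cyc_eq; first by apply: ietsV; exact: cycE.
by apply: is_cycleV => //; [exact: cycE|exact: cyc_cycle].
Qed.

Lemma cycVmoves x y z l : triad x y z l -> moves (cyc x y z l)^-1%g y x l.
Proof.
move=> /[dup] tr /triad_flip/[dup]tr1/triad_rot/[dup]tr2/triad_rot tr3.
by rewrite cycV // (cyc_rot tr1) (cyc_rot tr2); exact: cyc_moves.
Qed.

Lemma cycJ g x y z x' y' z' l : E g -> triad x y z l -> triad x' y' z' l ->
  moves g x' x l -> moves g y' y l -> moves g z' z l ->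
  (cyc x y z l ^ g)%g = cyc x' y' z' l.
Proof.
move=> Eg tr tr' gx gy gz; apply/esym/cyc_eq; first exact: ietsJ (cycE tr) Eg.
by apply: (is_cycleJ (cycE tr) Eg tr tr' (cyc_cycle tr)).
Qed.

Lemma cyc_supported x y z l : triad x y z l ->
  supported (cyc x y z l) (fun p => [|| in_arc x l p, in_arc y l p | in_arc z l p]).
Proof. by case/cyc_cycle. Qed.

Lemma cyc_fix x y z w l : triad x y z l -> arc X l w ->
  apart l x w -> apart l y w -> apart l z w -> moves (cyc x y z l) w w l.
Proof.
move=> tr [_ w0 w1] xw yw zw; apply: moves_id (cyc_supported tr) w0 w1 _ => p pw.
rewrite /in_arc !negb_or; apply/and3P; split.
- by move: xw; rewrite /apart; lra.
- by move: yw; rewrite /apart; lra.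
- by move: zw; rewrite /apart; lra.
Qed.

Lemma cyc0 x y z : triad x y z 0 -> cyc x y z 0 = 1%g.
Proof.
move=> tr; apply: cyc_eq => //; split=> [o|o|o|p p01 _]; try lra.
by rewrite ev1.
Qed.

Lemma cycD x y z a b : triad x y z (a + b) -> L a -> L b -> 0 <= a -> 0 <= b ->
  cyc x y z (a + b) = (cyc x y z a * cyc (x + a)%R (y + a)%R (z + a)%R b)%g.
Proof.
move=> tr La Lb a0 b0; have tra : triad x y z a by apply: triad_sub tr _ _ _ => //; lra.
have trb : triad (x + a) (y + a) (z + a) b by apply: triadS tr _ _ _ _ _ => //; lra.
have [f1 f2 f3 fS] := cyc_cycle tra; have [g1 g2 g3 gS] := cyc_cycle trb.
have Ef := cycE tra; have Eg := cycE trb.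
move: tr => [_ [[_ x0 x1] [_ y0 y1] [_ z0 z1]] [xy yz xz]].
apply: cyc_eq; first exact: ietsM.
have side u v w : moves (cyc x y z a) u v a ->
    moves (cyc (x + a) (y + a) (z + a) b) (u + a) (v + a) b ->
    0 <= u -> u + (a + b) <= 1 -> 0 <= v -> v + (a + b) <= 1 ->
    (forall o, 0 <= o < a -> ~~ [|| in_arc (x + a) b (u + o), in_arc (y + a) b (u + o)
       | in_arc (z + a) b (u + o)]) ->
    (forall o, a <= o < a + b -> ~~ [|| in_arc x a (v + o), in_arc y a (v + o)
       | in_arc z a (v + o)]) ->
    moves (cyc x y z a * cyc (x + a)%R (y + a)%R (z + a)%R b)%g u v (a + b).
  move=> fu gu u0 u1 v0 v1 ua va o ol; rewrite evM //; last lra.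
  have [oa|ao] := ltrP o a; first by rewrite gS ?fu //; [lra|lra|apply: ua; lra].
  have -> : u + o = u + a + (o - a) by lra.
  rewrite gu; last lra.
  have -> : v + a + (o - a) = v + o by lra.
  by rewrite fS //; [lra|apply: va; lra].
move: xy yz xz; rewrite /apart => xy yz xz.
split; try (apply: side => // o ol; rewrite /in_arc ?negb_or; lra).
by rewrite /in_arc => p p01 pA; rewrite evM // gS ?fS //; rewrite /in_arc; lra.
Qed.

(** Cycles can be moved one arc at a time by conjugation; [p] is an auxiliary
  arc. *)
Lemma cyc_replace x y z x' p l : triad x y z l -> triad x x' p l ->
  triad x' y z l -> triad p y z l ->
  (cyc x y z l ^ (cyc x x' p l)^-1)%g = cyc x' y z l.
Proof.
move=> t1 t2 t3 t4; have Eg := cycE t2; apply: cycJ => //; first exact: ietsV.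
  exact: cycVmoves.
- case: t1 t3 t4 => _ [_ ay _] [xy _ _] [_ _ [xy' _ _]] [_ _ [py _ _]].
  by case: (ay) => _ y0 y1; apply: movesV => //; apply: cyc_fix.
- case: t1 t3 t4 => _ [_ _ az] [_ _ xz] [_ _ [_ _ xz']] [_ _ [_ _ pz]].
  by case: (az) => _ z0 z1; apply: movesV => //; apply: cyc_fix.
Qed.

Lemma cycM a b c d l : triad a b c l -> triad a c d l -> triad b c d l ->
  triad a b d l -> (cyc a b c l * cyc a c d l)%g = cyc c d b l.
Proof.
move=> t1 t2 t3 t4; have [f1 f2 f3 fS] := cyc_cycle t1.
have [g1 g2 g3 gS] := cyc_cycle t2.
have Ef := cycE t1; have Eg := cycE t2.
have [_ [aa ab ac] [xab xbc xac]] := t1.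
have [_ [_ _ ad] [_ xcd xad]] := t2; have [_ _ [_ _ xbd]] := t3.
have fd : moves (cyc a b c l) d d l by apply: cyc_fix.
have gb : moves (cyc a c d l) b b l.
  by apply: cyc_fix; rewrite // apartC.
case: aa ab ac ad => [_ a0 a1] [_ b0 b1] [_ c0 c1] [_ d0 d1].
apply/esym/cyc_eq; first exact: ietsM.
split; try (by apply: movesM; eauto).
move=> p p01 pA; rewrite evM //.
have [pa|npa] := boolP (in_arc a l p).
  rewrite -(subrKC a p) g1 ?f3 //; move: pa; rewrite /in_arc; lra.
rewrite gS ?fS //; apply: contra pA; rewrite (negPf npa) /=.
  by case/orP => ->; rewrite ?orbT.
by case/orP => ->; rewrite ?orbT.
Qed.

(** As in the alternating group on five points, where the commutator of [(1 2 3)]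
  and [(3 4 5)] is a 3-cycle. *)
Lemma cycR x1 x2 x3 x4 x5 l : triad x1 x2 x3 l -> triad x3 x4 x5 l ->
  triad x1 x4 x2 l -> triad x1 x5 x2 l ->
  [~ cyc x1 x2 x3 l, cyc x3 x4 x5 l]%g = cyc x2 x5 x3 l.
Proof.
move=> t123 t345 t142 t152; have Eg := cycE t345.
have [H [a1 a2 a3] [x12 x23 x13]] := t123.
have [_ [_ a4 a5] [x34 x45 x35]] := t345.
have [_ _ [x14 x42 _]] := t142; have [_ _ [x15 x52 _]] := t152.
have t125 : triad x1 x2 x5 l by split=> //; split; rewrite // apartC.
rewrite commgEl cycV // (_ : _ ^ _ = cyc x1 x2 x5 l)%g; last first.
  apply: cycJ => //.
  - by apply: cyc_fix; rewrite // apartC.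
  - by apply: cyc_fix; rewrite // apartC.
  - rewrite (cyc_rot t345) (cyc_rot (triad_rot t345)).
    by apply: cyc_moves; do 2!apply: triad_rot.
by apply: cycM; split=> //; split; rewrite // apartC.
Qed.

(** The 3-cycles through two given points [k], [k'] generate an alternating
  group. *)
Lemma cyc_hub (P : set X) x y z k k' l : is_subgroup P ->
  triad x k k' l -> triad y k k' l -> triad z k k' l -> triad x y z l ->
  P (cyc x k k' l) -> P (cyc y k k' l) -> P (cyc z k k' l) -> P (cyc x y z l).
Proof.
move=> sP tx ty tz txyz Px Py Pz.
have [H [ax ak ak'] [xk kk' xk']] := tx; have [_ [ay _ _] [yk _ yk']] := ty.
have [_ [az _ _] [zk _ zk']] := tz; have [_ _ [xy yz xz]] := txyz.
have t1 : triad y k' x l by split=> //; split; rewrite // apartC.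
have t2 : triad k' z k l by split=> //; split; rewrite // apartC.
have t3 : triad k x y l by split=> //; split; rewrite // apartC.
have P1 : P (cyc y k' x l).
  suff <- : (cyc y k k' l ^ (cyc x k k' l)^-1)%g = cyc y k' x l.
    by apply: subgroupJ => //; exact: subgroupV.
  apply: cycJ => //; first by apply: ietsV; exact: cycE.
  - case: (ay) => _ y0 y1; apply: movesV => //; first exact: cycE.
    by apply: cyc_fix; rewrite // apartC.
  - by rewrite (cyc_rot tx); apply: cycVmoves; exact: triad_rot.
  - by rewrite cycV //; apply: cyc_moves; exact: triad_flip.
rewrite -(cyc_rot (triad_rot (triad_rot txyz))).
rewrite -(@cyc_replace k' x y z k) //; [|exact: triad_rot|do 2!apply: triad_rot => //].
apply: subgroupJ => //; first by rewrite -cyc_rot.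
by apply: subgroupV => //; rewrite -(cyc_rot (triad_rot (triad_rot t2)))
  -(cyc_rot (triad_rot t2)).
Qed.

End CycleCalculus.

(** * The subgroup generated by the cycles *)

#[local] Hint Resolve cycE : core.

Section AlternatingGroup.
Variables (R : realType) (X : iet_group R).
Local Notation L := (lengths X).
Local Notation E := (@iets R X).
Local Notation triad := (triad X).
Local Notation cyc := (cyc X).
Implicit Types (f g : X) (x y z l p : R).

Definition alt : set X := generated_subgroup
  [set c | exists x y z l, triad x y z l /\ c = cyc x y z l].

Lemma alt_subgroup : is_subgroup alt.
Proof. exact: generated_subgroupP. Qed.

Lemma cyc_alt x y z l : triad x y z l -> alt (cyc x y z l).
Proof. by move=> tr; apply: sub_generated; exists x, y, z, l. Qed.

Lemma alt_sub (P : set X) : is_subgroup P ->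
  (forall x y z l, triad x y z l -> P (cyc x y z l)) -> alt `<=` P.
Proof.
by move=> sP Pc; apply: generated_sub => // _ [x [y [z [l [tr ->]]]]]; exact: Pc.
Qed.

Lemma alt_iets : alt `<=` E.
Proof. by apply: alt_sub => [|*]; [exact: iets_subgroup|exact: cycE]. Qed.

(** A cycle is the product of its restrictions to the pieces of a subdivision of
  its arcs, and the subdivision can be chosen fine and adapted to the finite set
  [B] of offsets. *)
Lemma cyc_cut (P : set X) x y z l (B : seq R) (e : R) : is_subgroup P ->
  0 < e -> (forall b, b \in B -> L b) -> triad x y z l ->
  (forall o l', L o -> L l' -> 0 <= o -> 0 < l' -> o + l' <= l -> l' <= e ->
     (forall t, t \in B -> ~~ (o < t < o + l')) ->
     P (cyc (x + o) (y + o) (z + o) l')) ->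
  P (cyc x y z l).
Proof.
move=> sP e0 LB tr Ps; have [[Ll l0] _ _] := tr.
have [l00|lpos] : l = 0 \/ 0 < l by move: l0; rewrite le_eqVlt => /orP[/eqP|]; auto.
  by subst l; rewrite cyc0 //; exact: sP.1.
pose Q a b := P (cyc (x + a) (y + a) (z + a) (b - a)).
have QD a c b : L a -> L c -> L b -> 0 <= a -> b <= l -> a < c -> c < b ->
    Q a c -> Q c b -> Q a b.
  move=> La Lc Lb a0 bl ac cb; rewrite /Q.
  have -> : b - a = (c - a) + (b - c) by lra.
  move=> Qac Qcb; rewrite cycD; auto with lengths; try lra.
    apply: subgroupM => //; move: Qcb.
    by rewrite -!addrA [a + (c - a)]addrC subrK.
  by apply: triadS tr _ _ _ _ _; auto with lengths; lra.
suff : Q 0 l by rewrite /Q !addr0 subr0.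
apply: (@short_ind R X Q 0 l e) => //; last exact: lengths0.
move=> a b La Lb a0 ab bl; move: a b La Lb a0 ab bl.
apply: (@cut_ind R X (fun a b => b - a <= e -> Q a b) 0 l B) => //.
  move=> a c b La Lc Lb a0 bl ac cb Qac Qcb bae.
  by apply: (QD a c b) => //; [apply: Qac|apply: Qcb]; lra.
move=> a b La Lb a0 ab bl Bab bae; apply: Ps; auto with lengths; try lra.
by move=> t /Bab; lra.
Qed.

Lemma piece_moves f : E f -> exists2 B : seq R, forall b, b \in B -> L b &
  forall a l, L l -> 0 < l -> arc X l a ->
    (forall t, t \in B -> ~~ (a < t < a + l)) -> exists a', moves f a a' l.
Proof.
move=> /breakpoints[B LB Bf]; exists B => // a l Ll l0 [La a0 al1] Bal.
have [||||||c cE] := Bf a (a + l); auto with lengths; try lra.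
by exists (a + c) => o ol; rewrite cE; lra.
Qed.

(** Once the three arcs are cut at the breakpoints of the inverse of [g], that
  inverse translates them, and the conjugate by [g] is a cycle again. *)
Lemma alt_normal f g : E g -> alt f -> alt (f ^ g)%g.
Proof.
move=> Eg; have salt : is_subgroup [set f | alt (f ^ g)%g].
  split=> [|f' h fg hg]; first by rewrite /= conj1g; exact: alt_subgroup.1.
  by rewrite /= conjMg conjVg; exact: alt_subgroup.2.
move: f; apply: (alt_sub salt) => x y z l tr.
have [B LB Bg] := piece_moves (ietsV Eg).
pose C := [seq t - x | t <- B] ++ [seq t - y | t <- B] ++ [seq t - z | t <- B].
have [_ [[Lx x0 x1] [Ly y0 y1] [Lz z0 z1]] _] := tr.
have LC b : b \in C -> L b.
  by rewrite !mem_cat => /or3P[] /mapP[t /LB Lt ->]; auto with lengths.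
apply: (@cyc_cut [set f | alt (f ^ g)%g] x y z l C 1) => // o l' Lo Ll' o0 l'0 ol _ Col.
have tro := triadS tr Lo Ll' o0 (ltW l'0) ol.
have avoid w : (forall t, t \in B -> t - w \in C) ->
    forall t, t \in B -> ~~ (w + o < t < w + o + l').
  by move=> wC t /wC/Col; lra.
have inC w : w \in [:: x; y; z] -> forall t, t \in B -> t - w \in C.
  move=> + t tB; rewrite !inE !mem_cat => /or3P[] /eqP->; apply/or3P;
  [apply: Or31|apply: Or32|apply: Or33]; by apply/mapP; exists t.
have [_ [ax ay az] [xy yz xz]] := tro.
have [|x' gx] := Bg _ _ Ll' l'0 ax; first by apply/avoid/inC; rewrite inE eqxx.
have [|y' gy] := Bg _ _ Ll' l'0 ay; first by apply/avoid/inC; rewrite !inE eqxx orbT.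
have [|z' gz] := Bg _ _ Ll' l'0 az; first by apply/avoid/inC; rewrite !inE eqxx !orbT.
have EV := ietsV Eg.
have tr' : triad x' y' z' l'.
  split; first by split=> //; exact: ltW.
    by split; [exact: moves_arc gx|exact: moves_arc gy|exact: moves_arc gz].
  by split; [exact: (moves_apart EV ax ay gx gy)|exact: (moves_apart EV ay az gy gz)
    |exact: (moves_apart EV ax az gx gz)].
rewrite /= (cycJ Eg tro tr'); first exact: cyc_alt.
- by rewrite -[g]invgK; case: ax => _ ? ?; exact: movesV.
- by rewrite -[g]invgK; case: ay => _ ? ?; exact: movesV.
- by rewrite -[g]invgK; case: az => _ ? ?; exact: movesV.
Qed.

Definition rotates (r : X) x a b := forall p, 0 <= p < 1 -> ev r p = rotation_fun x a b p.

Lemma is_swapV s x y l : E s -> arc X l x -> arc X l y ->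
  is_swap s x y l -> is_swap s^-1%g x y l.
Proof.
move=> Es [_ ? ?] [_ ? ?] [sxy syx sS].
by split; [exact: movesV|exact: movesV|exact: supportedV].
Qed.

(** The commutator of the inverses of the exchanges [s], [t] of the first two and
  of the last two arcs is the square of a cycle, hence a cycle. *)
Lemma cyc_derived x y z l : triad x y z l -> derived_subgroup E (cyc x y z l).
Proof.
suff inv a b c : triad a b c l -> derived_subgroup E (cyc a c b l).
  by move=> tr; apply: inv; exact: triad_flip.
move=> tr; case: (tr) => [[Ll l0] [aa ab ac] [xab xbc _]].
have [s Es sP] := swap_ex Ll l0 aa ab xab.
have [t Et tP] := swap_ex Ll l0 ab ac xbc.
have E1 := cyc_eq (ietsM Es Et) (swap_swap_cycle Es Et tr sP tP).
have E2 := cyc_eq (ietsM (ietsV Es) (ietsV Et))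
  (swap_swap_cycle (ietsV Es) (ietsV Et) tr (is_swapV Es aa ab sP) (is_swapV Et ab ac tP)).
suff -> : cyc a c b l = [~ s^-1, t^-1]%g.
  by apply: sub_generated; exists s^-1%g; [|exists t^-1%g]; auto.
rewrite commgEl conjgE !invgK mulgA -E1 -E2.
have [c1 c2 c3 cS] := cyc_cycle tr; have Ec := cycE tr.
case: aa ab ac => [_ ? ?] [_ ? ?] [_ ? ?].
apply: cyc_eq; first exact: ietsM.
split; try by apply: movesM; eauto.
by apply: supportedM => //; apply: supportedS cS _ => p _; rewrite [X in _ || X]orbC.
Qed.

Lemma alt_derived : alt `<=` derived_subgroup E.
Proof. by apply: alt_sub => [|*]; [exact: generated_subgroupP|exact: cyc_derived]. Qed.

End AlternatingGroup.

(** * Rotations generate *)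

Section Rotations.
Variables (R : realType) (X : iet_group R).
Local Notation L := (lengths X).
Local Notation E := (@iets R X).
Local Notation triad := (triad X).
Local Notation cyc := (cyc X).
Local Notation alt := (alt X).
Implicit Types (f g r : X) (x y z l p : R).

Definition rotation_data x a b :=
  [/\ L x, L a & L b] /\ [/\ 0 <= x, 0 <= a, 0 <= b & x + a + b <= 1].

Definition rotations (e : R) : set X := [set r | E r /\ exists x a b,
  [/\ rotation_data x a b, a <= e, b <= e & rotates r x a b]].

Lemma rotation_exists x a b : rotation_data x a b -> exists2 r, E r & rotates r x a b.
Proof. by case=> [[Lx La Lb] [x0 a0 b0 x1]]; exact: rotation_ex. Qed.

Lemma rotates_eq r r' x a b : E r -> E r' -> rotates r x a b -> rotates r' x a b -> r = r'.
Proof. by move=> Er Er' rP rP'; apply: ev_inj => // p p01; rewrite rP ?rP'. Qed.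

Lemma rotates_trivial r x a b : E r -> a = 0 \/ b = 0 -> rotates r x a b -> r = 1%g.
Proof.
move=> Er ab rP; apply: ev_inj => // p p01; rewrite rP // ev1 // /rotation_fun.
by case: ab => ->; case: ifPn => ?; try case: ifPn => ?; lra.
Qed.

Lemma rotatesDl r1 r2 x a1 a2 b : E r1 -> E r2 ->
  0 <= a1 -> 0 <= a2 -> 0 <= b ->
  rotates r1 x a1 b -> rotates r2 (x + a1) a2 b -> rotates (r1 * r2)%g x (a1 + a2) b.
Proof.
move=> E1 E2 a10 a20 b0 P1 P2 p p01; have := ev_unit E2 p01.
rewrite evM // P2 // /rotation_fun.
by do 2?[case: ifPn => ?] => rp; rewrite P1 // /rotation_fun;
    do 4?[case: ifPn => ?]; lra.
Qed.

Lemma rotatesDr r1 r2 x a b1 b2 : E r1 -> E r2 ->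
  0 <= a -> 0 <= b1 -> 0 <= b2 ->
  rotates r1 (x + b1) a b2 -> rotates r2 x a b1 -> rotates (r1 * r2)%g x a (b1 + b2).
Proof.
move=> E1 E2 a0 b10 b20 P1 P2 p p01; have := ev_unit E2 p01.
rewrite evM // P2 // /rotation_fun.
by do 2?[case: ifPn => ?] => rp; rewrite P1 // /rotation_fun;
    do 4?[case: ifPn => ?]; lra.
Qed.

(** To exchange intervals of lengths [a1 + a2] and [b], exchange first those of
  lengths [a2] and [b], then those of lengths [a1] and [b]. This is iterated, on
  the left and on the right. *)
Lemma rotation_short (e : R) r x a b : 0 < e -> E r -> rotation_data x a b -> rotates r x a b ->
  generated_subgroup (rotations e) r.
Proof.
move=> e0 Er [[Lx La Lb] [x0 a0 b0 x1]] rP.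
set K := generated_subgroup _; have sK : is_subgroup K := generated_subgroupP _.
pose Q a b := forall x r, E r -> rotation_data x a b -> rotates r x a b -> K r.
suff Qab : Q a b by apply: (Qab x r Er _ rP); split.
have Q0 a' b' : a' = 0 \/ b' = 0 -> Q a' b'.
  by move=> ab y s Es _ sP; rewrite (rotates_trivial Es ab sP); exact: sK.1.
have Qb a' : a' <= e -> 0 < b -> Q a' b.
  move=> a'e b1; suff : Q a' (b - 0) by rewrite subr0.
  apply: (@short_ind R X (fun u v => Q a' (v - u)) 0 b e) => //; last exact: lengths0.
    move=> u v w Lu Lv Lw u0 wb uv vw Q1 Q2 y s Es.
    move=> [[Ly La' Lwu] [y0 a'0 wu0 y1]] sP.
    have [|r2 E2 P2] := @rotation_exists y a' (v - u).
      by split; split; auto with lengths; lra.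
    have [|r1 E1 P1] := @rotation_exists (y + (v - u)) a' (w - v).
      by split; split; auto with lengths; lra.
    have -> : s = (r1 * r2)%g.
      apply: (rotates_eq Es (ietsM E1 E2) sP).
      rewrite (_ : w - u = v - u + (w - v)); last by lra.
      by apply: rotatesDr E1 E2 _ _ _ P1 P2; lra.
    by apply: subgroupM sK _ _; [apply: (Q2 _ _ E1 _ P1)|apply: (Q1 _ _ E2 _ P2)];
      split; split; auto with lengths; lra.
  move=> u v Lu Lv u0 uv vb vue y s Es dat sP.
  by apply: sub_generated; split=> //; exists y, a', (v - u).
have [b00|bpos] : b = 0 \/ 0 < b by move: b0; rewrite le_eqVlt => /orP[/eqP|]; auto.
  by apply: Q0; right.
have [a00|apos] : a = 0 \/ 0 < a by move: a0; rewrite le_eqVlt => /orP[/eqP|]; auto.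
  by apply: Q0; left.
suff : Q (a - 0) b by rewrite subr0.
apply: (@short_ind R X (fun u v => Q (v - u) b) 0 a e) => //; last exact: lengths0.
  move=> u v w Lu Lv Lw u0 wb uv vw Q1 Q2 y s Es.
  move=> [[Ly Lwu Lb'] [y0 wu0 b'0 y1]] sP.
  have [|r1 E1 P1] := @rotation_exists y (v - u) b.
    by split; split; auto with lengths; lra.
  have [|r2 E2 P2] := @rotation_exists (y + (v - u)) (w - v) b.
    by split; split; auto with lengths; lra.
  have -> : s = (r1 * r2)%g.
    apply: (rotates_eq Es (ietsM E1 E2) sP).
    rewrite (_ : w - u = v - u + (w - v)); last by lra.
    by apply: rotatesDl E1 E2 _ _ _ P1 P2; lra.
  by apply: subgroupM sK _ _; [apply: (Q1 _ _ E1 _ P1)|apply: (Q2 _ _ E2 _ P2)];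
    split; split; auto with lengths; lra.
by move=> u v Lu Lv u0 uv va vue; exact: Qb.
Qed.

(** The pieces of [f] from [t] on, as pairs of a length and of the image of the
  left endpoint. Recording this image rather than the translation keeps the
  pairs unchanged when [f] is composed on the right with a permutation of its
  pieces. *)
Fixpoint pieces f t (s : seq (R * R)) : Prop :=
  if s is (l, c) :: s' then [/\ 0 < l, L l, moves f t c l & pieces f (t + l) s']
  else True.

Definition total (s : seq (R * R)) := \sum_(i <- s) i.1.

Lemma total_cons l c s : total ((l, c) :: s) = l + total s.
Proof. by rewrite /total big_cons. Qed.

Lemma total_cat s1 s2 : total (s1 ++ s2) = total s1 + total s2.
Proof. by rewrite /total big_cat. Qed.

Lemma pieces_cat f t s1 s2 :
  pieces f t (s1 ++ s2) <-> pieces f t s1 /\ pieces f (t + total s1) s2.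
Proof.
elim: s1 t => [|[l c] s1 IH] t /=; first by rewrite /total big_nil addr0; tauto.
rewrite total_cons addrA; split=> [[? ? ?]|[[? ? ?] ?] ?].
  by move/IH => [].
by split=> //; apply/IH.
Qed.

Lemma pieces_total f t s : pieces f t s -> L (total s) /\ 0 <= total s.
Proof.
elim: s t => [|[l c] s IH] t /=; first by rewrite /total big_nil; split=> //; exact: lengths0.
move=> [l0 Ll _ /IH[Ls s0]]; rewrite total_cons; split; first exact: lengthsD.
by lra.
Qed.

Lemma pieces_shift f g t l s : pieces f t s ->
  (forall p, t <= p < t + total s -> ev g (p + l) = ev f p) -> pieces g (t + l) s.
Proof.
elim: s t => [//|[k c] s IH] t /= [k0 Lk fk fs] gf.
have [_ s0] := pieces_total fs; rewrite total_cons in gf; split=> //.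
  by move=> o ok; rewrite addrAC gf ?fk //; lra.
by rewrite addrAC; apply: IH => // p pk; apply: gf; lra.
Qed.

Lemma pieces_ex f : E f -> exists2 s, pieces f 0 s & total s = 1.
Proof.
move=> /piece_moves[B LB Bf].
suff : exists2 s, pieces f 0 s & total s = 1 - 0 by rewrite subr0.
apply: (@cut_ind R X (fun a b => exists2 s, pieces f a s & total s = b - a) 0 1 B) => //.
- move=> a c b La Lc Lb a0 b1 ac cb [s1 p1 t1] [s2 p2 t2]; exists (s1 ++ s2).
    by apply/pieces_cat; split=> //; rewrite t1 addrC subrK.
  by rewrite total_cat t1 t2; lra.
- move=> a b La Lb a0 ab b1 Bab; have [||||c fc] := Bf a (b - a).
  + exact: lengthsB.
  + by lra.
  + by split=> //; lra.
  + by move=> t /Bab; lra.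
  exists [:: (b - a, c)]; last by rewrite total_cons /total big_nil addr0.
  by split=> //; [lra|exact: lengthsB].
- exact: lengths0.
- exact: lengths1.
Qed.

Lemma pieces_find f t s z : pieces f t s -> t <= z < t + total s ->
  exists s1 l c s2, s = s1 ++ (l, c) :: s2 /\ t + total s1 <= z < t + total s1 + l.
Proof.
elim: s t => [|[l c] s IH] t /=; first by rewrite /total big_nil; lra.
move=> [l0 Ll fl fs]; rewrite total_cons => zt.
have [zl|lz] := ltrP z (t + l).
  by exists [::], l, c, s; split=> //; rewrite /total big_nil; lra.
have [|s1 [k [d [s2 [-> zk]]]]] := IH (t + l) fs; first by lra.
by exists ((l, c) :: s1), k, d, s2; split=> //; rewrite total_cons; lra.
Qed.

(** Sorting: if [f] is the identity on [[0, t)], then the piece that contains the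
  preimage of [t] starts there, and a rotation brings it next to [[0, t)]. *)
Lemma rotations_generate f : E f -> generated_subgroup (rotations 1) f.
Proof.
move=> Ef; have [s fs s1] := pieces_ex Ef.
set K := generated_subgroup _; have sK : is_subgroup K := generated_subgroupP _.
suff sort n t s' g : E g -> size s' = n -> L t -> 0 <= t -> t + total s' = 1 ->
    (forall p, 0 <= p < t -> ev g p = p) -> pieces g t s' -> K g.
  by apply: (sort (size s) 0 s) => //; [exact: lengths0|rewrite add0r|move=> p; lra].
move: s' t g => {f s Ef fs s1}s t f.
elim: n s t f => [|n IHn] s t f Ef szs Lt t0 ts fid fs.
  rewrite (size0nil szs) /total big_nil addr0 in ts; subst t.
  suff -> : f = 1%g by exact: sK.1.
  by apply: ev_inj => // p p01; rewrite fid // ev1.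
have t1 : t < 1.
  case: s szs fs ts => // [[l c] s] _ /= [l0 _ _ /pieces_total[_ s0]].
  by rewrite total_cons; lra.
have t01 : 0 <= t < 1 by lra.
pose z := ev f^-1%g t; have z01 : 0 <= z < 1 by apply: ev_unit => //; exact: ietsV.
have fz : ev f z = t by exact: evVK.
have tz : t <= z by rewrite leNgt; apply/negP => zt; move: (fz); rewrite fid; lra.
have [|s1 [l [c [s2 [sE zl]]]]] := pieces_find fs (z := z); first by lra.
move: fs; rewrite {}sE in szs ts *.
case/pieces_cat => fs1 /= [l0 Ll fl fs2].
have [Ls1 s10] := pieces_total fs1; have [Ls2 s20] := pieces_total fs2.
rewrite total_cat total_cons in ts.
pose y := t + total s1; rewrite -/y in zl fl fs2.
have fy : ev f y = c by rewrite -[y]addr0 fl ?addr0 //; lra.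
have c01 : 0 <= c < 1 by rewrite -fy ev_unit //; rewrite /y; lra.
have cle : c <= t.
  by rewrite -fz -(subrKC y z) fl; lra.
have ct : c = t.
  apply/eqP; rewrite eq_le cle leNgt; apply/negP => c_t.
  have : y = c by apply: (ev_injective Ef) => //; [rewrite /y; lra|rewrite fy fid //; lra].
  by rewrite /y; lra.
subst c.
have [|r Er rP] := @rotation_exists t l (total s1).
  by split; split=> //; lra.
have Kr : K r.
  apply: sub_generated; split=> //; exists t, l, (total s1).
  by split=> //; [split; split=> //; lra|lra|lra].
suff : K (f * r)%g.
  move=> Kfr; rewrite -[f](mulgK r); exact: subgroupM sK Kfr (subgroupV sK Kr).
have Efr := ietsM Ef Er.
apply: (IHn (s1 ++ s2) (t + l)) => //.
- by move: szs; rewrite !size_cat /= addnS => -[].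
- exact: lengthsD.
- by lra.
- by rewrite total_cat; lra.
- move=> p pt; rewrite (evM Ef Er) ?rP /rotation_fun; try lra.
  case: ifPn => [h|h]; last by case: ifPn => ?; rewrite ?fid; lra.
  rewrite (_ : p + total s1 = y + (p - t)) ?fl /y; lra.
- apply/pieces_cat; split.
    apply: pieces_shift fs1 _ => p pt; rewrite (evM Ef Er) ?rP /rotation_fun; try lra.
    by case: ifPn => ?; try case: ifPn => ?; try lra; congr ev; lra.
  rewrite addrAC -/y -[y + l]addr0; apply: (pieces_shift fs2) => p.
  rewrite addr0 /y => pt; rewrite (evM Ef Er) ?rP /rotation_fun; try lra.
  by case: ifPn => ?; try case: ifPn => ?; lra.
Qed.

End Rotations.

(** * The derived subgroup and its simplicity *)

Section Derived.
Variables (R : realType) (X : iet_group R).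
Local Notation L := (lengths X).
Local Notation E := (@iets R X).
Local Notation triad := (triad X).
Local Notation cyc := (cyc X).
Local Notation alt := (@alt R X).
Implicit Types (f g r : X) (x y z l p : R).

Lemma free_arc (w : R) (xs : seq R) : 0 <= w -> L w ->
  (2 * size xs).+1%:R * w <= 1 -> (forall x, x \in xs -> arc X w x) ->
  exists2 z, arc X w z & forall x, x \in xs -> apart w x z.
Proof.
move=> w0 Lw small axs; have [|x /axs[]//|z [Lz z0 far]] := @room R X w xs 0 w0 Lw.
  exact: lengths0.
exists z => //; split=> //; first by lra.
by move: small; rewrite -natr1 mulrDl; lra.
Qed.

Lemma rotates_supported r x a b : rotates r x a b -> 0 <= a -> 0 <= b ->
  supported r (in_arc x (a + b)).
Proof.
move=> rP a0 b0 p p01; rewrite /in_arc rP // /rotation_fun => h.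
by case: ifPn => ?; try case: ifPn => ?; lra.
Qed.

(** Conjugation by a cycle, which is trivial modulo [alt], makes the supports
  disjoint. *)
Lemma small_support_commg f g x y w : E f -> E g -> L w -> 0 <= w -> 7 * w <= 1 ->
  arc X w x -> arc X w y -> supported f (in_arc x w) -> supported g (in_arc y w) ->
  alt [~ f, g]%g.
Proof.
move=> Ef Eg Lw w0 w1 ax ay fx gy; have salt := alt_subgroup X.
have [|u|y' ay' far'] := @free_arc w [:: x; y] w0 Lw.
- by rewrite /=; lra.
- by rewrite !inE => /orP[]/eqP->.
have [|u|y'' ay'' far''] := @free_arc w [:: x; y; y'] w0 Lw.
- by rewrite /=; lra.
- by rewrite !inE => /or3P[]/eqP->.
have tr : triad y y' y'' w.
  by split=> //; split; [apply: far'|apply: far''|apply: far'']; rewrite !inE eqxx ?orbT.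
have Ec := cycE tr; set c := cyc _ _ _ _ in Ec.
pose u := (g ^ c^-1)%g; have Eu : E u by apply: ietsJ => //; exact: ietsV.
have fu : commute f u.
  have uy' : supported u (in_arc y' w).
    case: (ay') => _ y'0 y'1; apply: supportedJ Eg (ietsV Ec) gy _ y'0 y'1.
    exact: cycVmoves tr.
  apply: (supported_commute Ef Eu fx uy') => p _.
  have : apart w x y' by apply: far'; rewrite inE eqxx.
  by rewrite /apart /in_arc; lra.
have au : alt (u^-1 * g)%g.
  have -> : g = (u ^ c)%g by rewrite /u conjgKV.
  rewrite -commgEl commgEr; apply: (subgroupM salt _ (cyc_alt tr)).
  exact: alt_normal Eu (subgroupV salt (cyc_alt tr)).
clearbody u; have -> : [~ f, g]%g = (((u^-1 * g)^-1) ^ f * (u^-1 * g))%g.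
  by rewrite commgEl !conjgE !invgM !invgK !mulgA -[(_ * u * f)%g]mulgA
    -[(u * f)%g]fu !mulgA mulgK.
exact: subgroupM salt (alt_normal Ef (subgroupV salt au)) au.
Qed.

(** Short rotations generate [iets] and commute modulo [alt]. *)
Lemma derived_alt : derived_subgroup E = alt.
Proof.
apply/seteqP; split; last exact: alt_derived.
have [e Le /andP[e0 e14]] := @lengths_dense _ X (1/14) ltac:(lra).
apply: generated_sub; first exact: alt_subgroup.
move=> _ [f Ef [g Eg <-]].
have gen h : E h -> generated_subgroup (@rotations R X e) h.
  move=> /rotations_generate; apply: generated_sub; first exact: generated_subgroupP.
  move=> r [Er [x [a [b [dat _ _ rP]]]]]; exact: rotation_short rP.
have gen_iets : generated_subgroup (@rotations R X e) `<=` E.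
  by apply: generated_sub; [exact: iets_subgroup|move=> r []].
apply: (generated_commg (alt_subgroup X) _ _ (gen f Ef) (gen g Eg)).
  by move=> x y /gen_iets; exact: alt_normal.
have small r : @rotations R X e r -> exists2 x, arc X (2 * e) x & supported r (in_arc x (2 * e)).
  move=> [Er [x [a [b [[[Lx La Lb] [x0 a0 b0 x1]] ae be rP]]]]].
  have rS := rotates_supported rP a0 b0.
  have [xe|xe] := lerP (x + 2 * e) 1.
    exists x; first by split.
    by apply: supportedS rS _ => p _; rewrite /in_arc; lra.
  exists (1 - 2 * e); first by split; auto with lengths; lra.
  by apply: supportedS rS _ => p _; rewrite /in_arc; lra.
move=> r s rr rs; have [x ax rx] := small r rr; have [y ay sy] := small s rs.
case: rr rs => Er _ [Es _].
apply: (small_support_commg Er Es _ _ _ ax ay rx sy); auto with lengths; lra.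
Qed.

End Derived.

Section Simplicity.
Variables (R : realType) (X : iet_group R).
Local Notation L := (lengths X).
Local Notation E := (@iets R X).
Local Notation triad := (triad X).
Local Notation cyc := (cyc X).
Local Notation alt := (@alt R X).
Implicit Types (f g r : X) (x y z l p : R).

(** Take a piece on which [f] is not the identity, and shorten it to less than
  the length of the translation. *)
Lemma displaced_arc f : E f -> f <> 1%g -> exists x x' w,
  [/\ L w, 0 < w, arc X w x & moves f x x' w] /\ apart w x x'.
Proof.
move=> Ef f1; apply: contrapT => nodisp; apply: f1.
have [B LB Bf] := piece_moves Ef.
suff fid : forall p, 0 <= p < 1 -> ev f p = p.
  by apply: ev_inj => // p p01; rewrite ev1 // fid.
apply: (@cut_ind R X (fun a b => forall p, a <= p < b -> ev f p = p) 0 1 B) => //.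
- move=> a c b _ _ _ _ _ _ _ Qac Qcb p pab.
  by have [pc|cp] := ltrP p c; [apply: Qac|apply: Qcb]; lra.
- move=> a b La Lb a0 ab b1 Bab; have arc_ab : arc X (b - a) a by split=> //; lra.
  have [|||a' fa] := Bf a (b - a) _ _ arc_ab.
  + exact: lengthsB.
  + by lra.
  + by move=> t /Bab; lra.
  have [aa' p pab|aa'] := eqVneq a a'; first by rewrite -{1}(subrKC a p) fa; lra.
  exfalso; apply: nodisp; set m := Num.min (b - a) `|a' - a|.
  have d0 : 0 < `|a' - a| by rewrite normr_gt0 subr_eq0 eq_sym.
  have [|w Lw /andP[w0 wm]] := @lengths_dense _ X m; first by rewrite lt_min d0 andbT; lra.
  move: wm; rewrite lt_min => /andP[wab wd]; exists a, a', w; split.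
    split=> //; first by split=> //; lra.
    by rewrite -(addr0 a) -(addr0 a'); apply: movesS fa _ _; lra.
  move: wd; rewrite /apart; case: ger0P => _; lra.
- exact: lengths0.
- exact: lengths1.
Qed.

(** As [f] moves the common support of [g] and [h] off itself, the conjugate [q]
  of [g] by the inverse of [f] commutes with [h]. With [u = g^-1 * q], which is in
  [N], it follows that [~ g, h] and [~ u^-1, h] are equal. *)
Lemma commutator_in_normal (N : set X) f g h (A B : R -> bool) : normal_subgroup N alt -> N f ->
  alt g -> alt h -> supported g A -> supported h A ->
  (forall p, 0 <= p < 1 -> A p -> B (ev f p)) ->
  (forall p, 0 <= p < 1 -> A p -> ~~ B p) -> N [~ g, h]%g.
Proof.
move=> [sN NA nN] Nf ag ah gA hA fAB AB.
have Ef := alt_iets (NA f Nf); have Eg := alt_iets ag; have Eh := alt_iets ah.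
pose q := (g ^ f^-1)%g; have Eq : E q by apply: ietsJ => //; exact: ietsV.
have qB : supported q B.
  move=> p p01 nBp; have fp := ev_unit (ietsV Ef) p01.
  rewrite /q conjgE invgK evM //; last exact: ietsM (ietsV Ef).
  rewrite evM //; last exact: ietsV.
  rewrite gA ?evVK //; apply: contra nBp => Afp.
  by rewrite -(evVK Ef p01) fAB.
have qh : commute q h.
  by apply: commute_sym; apply: (supported_commute Eh Eq hA qB).
pose u := (g^-1 * q)%g.
have Nu : N u.
  have -> : u = ((f^-1)^-1 ^ g * f^-1)%g.
    by rewrite /u /q !conjgE !invgK !mulgA.
  apply: (subgroupM sN _ (subgroupV sN Nf)).
  exact: nN ag (subgroupV sN (subgroupV sN Nf)).
have -> : [~ g, h]%g = (u * (u^-1) ^ h)%g.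
  clearbody q; rewrite commgEl /u !conjgE invgM invgK !mulgA.
  rewrite -[(g^-1 * q * h^-1)%g]mulgA (commuteV qh) mulgA.
  by rewrite -[(_ * q * q^-1)%g]mulgA mulgV mulg1.
exact: subgroupM sN Nu (nN _ _ ah (subgroupV sN Nu)).
Qed.

(** The arcs are moved one at a time, first to a position that is apart from both
  triads, then to the second triad, so that they never collide. *)
Lemma normal_cycles (N : set X) x y z x' y' z' l : normal_subgroup N alt ->
  17 * l <= 1 -> triad x y z l -> triad x' y' z' l -> N (cyc x y z l) -> N (cyc x' y' z' l).
Proof.
move=> [sN NA nN] l1 tr tr' Nc.
have [[Ll l0] [ax ay az] [xy yz xz]] := tr.
have [_ [ax' ay' az'] [xy' yz' xz']] := tr'.
have step a b c d : triad a b c l -> triad d b c l -> apart l a d ->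
    N (cyc a b c l) -> N (cyc d b c l).
  move=> t1 t2 ad N1; have [_ [aa ab ac] [xab xbc xac]] := t1.
  have [_ [ad' _ _] [xdb _ xdc]] := t2.
  have [|w|p ap far] := @free_arc R X l [:: a; b; c; d] l0 Ll.
  - by rewrite /=; lra.
  - by rewrite !inE => /or4P[] /eqP->.
  have t3 : triad a d p l by split=> //; split=> //; apply: far; rewrite !inE eqxx ?orbT.
  rewrite -(@cyc_replace R X a b c d p) //.
    exact: nN _ _ (subgroupV (alt_subgroup X) (cyc_alt t3)) N1.
  by split=> //; split=> //; rewrite apartC; apply: far; rewrite !inE eqxx ?orbT.
have rot a b c : triad a b c l -> N (cyc a b c l) -> N (cyc b c a l).
  by move=> t; rewrite (cyc_rot t).
have move_all a b c a' b' c' : triad a b c l -> triad a' b' c' l ->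
    (forall u, u \in [:: a; b; c] -> forall v, v \in [:: a'; b'; c'] -> apart l u v) ->
    N (cyc a b c l) -> N (cyc a' b' c' l).
  move=> t t' far Na; have [_ [aa ab ac] [xab xbc xac]] := t.
  have [_ [aa' ab' ac'] [xab' xbc' xac']] := t'.
  have f u v : u \in [:: a; b; c] -> v \in [:: a'; b'; c'] -> apart l u v.
    by move=> uu vv; exact: far.
  have t1 : triad a' b c l.
    by split=> //; split=> //; rewrite apartC; apply: f; rewrite !inE eqxx ?orbT.
  have t2 : triad b' c a' l.
    split=> //; split=> //; last by rewrite apartC.
      by rewrite apartC; apply: f; rewrite !inE eqxx ?orbT.
    by apply: f; rewrite !inE eqxx ?orbT.
  have t3 : triad c' a' b' l by do 2!apply: triad_rot.
  have N1 : N (cyc a' b c l).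
    by apply: (step a) => //; apply: f; rewrite !inE eqxx ?orbT.
  have N2 : N (cyc b' c a' l).
    apply: (step b) => //; first exact: triad_rot.
      by apply: f; rewrite !inE eqxx ?orbT.
    exact: rot.
  apply: (rot _ _ _ t3); apply: (step c) => //; first exact: triad_rot.
    by apply: f; rewrite !inE eqxx ?orbT.
  exact: (rot _ _ _ t2).
have [|w|m1 am1 far1] := @free_arc R X l [:: x; y; z; x'; y'; z'] l0 Ll.
- by rewrite /=; lra.
- by rewrite !inE => /or3P[/eqP->|/eqP->|/or4P[]/eqP->].
have [|w|m2 am2 far2] := @free_arc R X l [:: x; y; z; x'; y'; z'; m1] l0 Ll.
- by rewrite /=; lra.
- by rewrite !inE => /or4P[/eqP->|/eqP->|/eqP->|/or4P[]/eqP->].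
have [|w|m3 am3 far3] := @free_arc R X l [:: x; y; z; x'; y'; z'; m1; m2] l0 Ll.
- by rewrite /=; lra.
- by rewrite !inE => /or4P[/eqP->|/eqP->|/eqP->|/orP[/eqP->|/or4P[]/eqP->]].
have trm : triad m1 m2 m3 l.
  by split=> //; split=> //; [apply: far2|apply: far3|apply: far3];
    rewrite !inE eqxx ?orbT.
apply: (move_all m1 m2 m3) => //; last first.
  apply: (move_all x y z) => // u uxyz v.
  by rewrite !inE => /or3P[] /eqP->; [apply: far1|apply: far2|apply: far3];
    move: uxyz; rewrite !inE => /or3P[] /eqP->; rewrite eqxx ?orbT.
move=> u um v; move: um; rewrite !inE apartC => um.
by move=> vx; case/or3P: um => /eqP->; [apply: far1|apply: far2|apply: far3];
  case/or3P: vx => /eqP->; rewrite !inE eqxx ?orbT.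
Qed.

(** A nontrivial normal subgroup contains the commutators of the elements
  supported on some arc, in particular a cycle of arbitrarily short arcs, hence
  all the cycles of such arcs, which generate. *)
Lemma alt_simple : simple_group alt.
Proof.
split=> [alt1|N nN].
  have [w Lw /andP[w0 w3]] := @lengths_dense _ X (1/3) ltac:(lra).
  have tr : triad 0 w (w + w) w.
    split; first by split=> //; lra.
      by split; (split; [auto with lengths|lra|lra]).
    by split; rewrite /apart; lra.
  have : cyc 0 w (w + w) w = 1%g.
    by have := cyc_alt tr; rewrite alt1.
  move=> /(congr1 (fun f => ev f (0 + 0))); rewrite (cyc_moves tr); last lra.
  by rewrite addr0 ev1; lra.
have [sN NA _] := nN.
have [N1|/existsNP[f /not_implyP[Nf f1]]] := pselect (forall f, N f -> f = 1%g).
  by left; apply/seteqP; split=> [f /N1//|_ ->]; exact: sN.1.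
right; apply/seteqP; split=> // g.
have Ef := alt_iets (NA f Nf).
have [x [x' [w [[Lw w0 [Lx x0 x1] fxx'] xx']]]] := displaced_arc Ef f1.
(* cycles of length up to w / 5 fit five times in the arc moved by f *)
have short l : L l -> 0 < l -> 5 * l <= w -> exists a b c, triad a b c l /\ N (cyc a b c l).
  move=> Ll l0 lw; pose y k := x + k%:R * l.
  have tri i j k : (i < 5)%N -> (j < 5)%N -> (k < 5)%N ->
      i != j -> j != k -> i != k -> triad (y i) (y j) (y k) l.
    have ar i' : (i' < 5)%N -> arc X l (y i').
      move=> i5; split; rewrite /y; first by auto with lengths.
        by rewrite addr_ge0 // mulr_ge0 // ltW.
      have : (i'%:R : R) <= 4 by rewrite ler_nat.
      by nra.
    have ap i' j' : i' != j' -> apart l (y i') (y j').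
      rewrite neq_ltn => /orP[] ij; apply/orP; [left|right]; rewrite /y -addrA lerD2l;
        by rewrite -[X in _ + X]mul1r -mulrDl ler_pM2r // natr1 ler_nat.
    by move=> i5 j5 k5 ij jk ik; split; split; auto; exact: ltW.
  have t1 : triad (y 0) (y 1) (y 2) l by exact: tri.
  have t2 : triad (y 2) (y 3) (y 4) l by exact: tri.
  have t3 : triad (y 0) (y 3) (y 1) l by exact: tri.
  have t4 : triad (y 0) (y 4) (y 1) l by exact: tri.
  exists (y 1%N), (y 4%N), (y 2%N); split; first exact: tri.
  rewrite -(cycR t1 t2 t3 t4).
  have inx i j k : triad (y i) (y j) (y k) l -> (i < 5)%N -> (j < 5)%N -> (k < 5)%N ->
      supported (cyc (y i) (y j) (y k) l) (in_arc x w).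
    move=> t i5 j5 k5; apply: supportedS (cyc_supported t) _ => p _.
    have yb i' : (i' < 5)%N -> in_arc (y i') l p -> in_arc x w p.
      move=> i5'; have : (i'%:R : R) <= 4 by rewrite ler_nat.
      by have := ler0n R i'; rewrite /in_arc /y; nra.
    by move=> /or3P[]; apply: yb.
  apply: (@commutator_in_normal N f _ _ (in_arc x w) (in_arc x' w)) => //.
  - exact: cyc_alt.
  - exact: cyc_alt.
  - exact: inx.
  - exact: inx.
  - move=> p p01; rewrite /in_arc => px; rewrite -(subrKC x p) fxx'; lra.
  - by move=> p _; move: xx'; rewrite /apart /in_arc; lra.
have [|e Le /andP[e0 ew]] := @lengths_dense _ X (Num.min (w / 5) (1 / 17)).
  by rewrite lt_min; lra.
move: ew; rewrite lt_min => /andP[ew e17].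
move: g; apply: alt_sub => // a b c l tr.
apply: (@cyc_cut R X N a b c l [::] e) => // o l' Lo Ll' o0 l'0 ol le _.
have [|u [v [t [truvt Nuvt]]]] := short l' Ll' l'0; first by lra.
apply: normal_cycles truvt _ Nuvt => //; first by lra.
by apply: triadS tr _ _ _ _ _ => //; lra.
Qed.

End Simplicity.

(** * Zones *)

Section SmallGenerators.
Variables (R : realType) (X : iet_group R).
Local Notation L := (lengths X).

(** Finite generation of the group of lengths, in the form of an induction
  principle. *)
Definition lengths_generated := exists2 s : seq R, forall a, a \in s -> L a &
  forall A : set R, A 0 -> (forall a b, A a -> A b -> A (a - b)) ->
    (forall a, a \in s -> A a) -> L `<=` A.

(** Take a short [u] and, for each generator [a], the difference between [u] and
  the remainder of [a] modulo [u], which unlike the remainder is not 0. *)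
Lemma small_generators e : 0 < e -> lengths_generated ->
  exists2 S : seq R, forall s, s \in S -> L s /\ 0 < s <= e &
    forall a, L a -> exists2 ws, forall w, w \in ws -> (w \in S) || (- w \in S) &
      a = \sum_(w <- ws) w.
Proof.
move=> e0 [gens Lgens gensP]; have [u Lu /andP[u0 ue]] := @lengths_dense _ X e e0.
pose r a := u - (a - (Num.floor (a / u))%:~R * u).
pose S := u :: [seq r a | a <- gens].
have Lz (z : int) : L (z%:~R * u).
  case: z => n; first exact: lengthsMn.
  by rewrite NegzE mulrNz mulNr; apply/lengthsN/lengthsMn.
exists S => [s|].
  rewrite inE => /orP[/eqP->|/mapP[a /Lgens La ->]]; first by split=> //; lra.
  split; first by apply: lengthsB => //; exact: lengthsB.
  have := floor_itv (a / u); rewrite intrD1 ler_pdivlMr // ltr_pdivrMr // mulrDl.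
  by rewrite /r; lra.
pose A : set R := [set a | exists2 ws, forall w, w \in ws -> (w \in S) || (- w \in S) &
      a = \sum_(w <- ws) w].
have A0 : A 0 by exists [::]; rewrite // big_nil.
have AB a b : A a -> A b -> A (a - b).
  move=> [ws wsS ->] [vs vsS ->]; exists (ws ++ [seq - v | v <- vs]).
    move=> w; rewrite mem_cat => /orP[/wsS//|/mapP[v /vsS vS ->]].
    by rewrite opprK orbC.
  by rewrite big_cat big_map sumrN.
have AS s : s \in S -> A s.
  by move=> sS; exists [:: s]; rewrite ?big_seq1 // => w; rewrite inE => /eqP->; rewrite sS.
have AN a : A a -> A (- a) by move=> Aa; rewrite -sub0r; exact: AB.
have AD a b : A a -> A b -> A (a + b).
  by move=> Aa Ab; rewrite -[b]opprK; exact: AB (AN _ Ab).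
have Au : A u by apply: AS; rewrite inE eqxx.
have Anu n : A (n%:R * u).
  by elim: n => [|n IH]; rewrite ?mul0r // -natr1 mulrDl mul1r; exact: AD.
have Azu (z : int) : A (z%:~R * u).
  by case: z => n; [exact: Anu|rewrite NegzE mulrNz mulNr; apply: AN; exact: Anu].
apply: gensP => // a ags; have -> : a = (Num.floor (a / u))%:~R * u + u - r a.
  by rewrite /r; lra.
by apply: AB; [exact: AD|apply: AS; rewrite inE map_f ?orbT].
Qed.

End SmallGenerators.

Section Zones.
Variables (R : realType) (X : iet_group R).
Local Notation L := (lengths X).
Local Notation E := (@iets R X).
Local Notation triad := (triad X).
Local Notation cyc := (cyc X).
Local Notation alt := (@alt R X).
Implicit Types (f g r : X) (x y z l p a o s : R).

(** Since [4N < 1 < 5N], the zones 0, 1, 2, 3 and the interval [[1 - N, 1)] cover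
  [[0, 1)], and [[0, 1)] contains the four zones. The hypotheses on [P] are
  satisfied by a finitely generated subgroup of [alt]. *)
Variables (N : R) (S : seq R) (P : set X).
Hypotheses (LN : L N) (N_bounds : 1 / 5 < N < 1 / 4).
Hypothesis S_small : forall s, s \in S -> L s /\ 0 < s <= N / 4.
Hypothesis S_gen : forall a, L a ->
  exists2 ws, forall w, w \in ws -> (w \in S) || (- w \in S) & a = \sum_(w <- ws) w.
Hypothesis P_subgroup : is_subgroup P.

Definition zone (i : nat) := i%:R * N.
Definition in_zone i x a := [/\ L x, zone i <= x & x + a <= zone i + N].

(** The zone 3 serves to compensate the rotation of the zone [i], which need not be
  in [alt] by itself. *)
Definition zone_shift i s g := [/\ E g, moves g (zone i) (zone i + s) (N - s) &
  supported g (fun p => in_arc (zone i) N p || in_arc (zone 3) N p)].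

Hypothesis P_shift : forall i s, (i < 3)%N -> s \in S -> exists2 g, P g & zone_shift i s g.
Hypothesis P_base : forall s, s \in S -> P (cyc (zone 0) (zone 1) (zone 2) s).
Hypothesis P_zones : P (cyc (zone 1) (zone 2) (zone 3) N).
Hypothesis P_last : P (cyc (1 - N) (zone 1) (zone 2) N).

Lemma zone_lengths i : L (zone i). Proof. exact: lengthsMn. Qed.
Hint Resolve zone_lengths LN : lengths.

Let N_gt0 : 0 < N. Proof. by move: N_bounds; lra. Qed.

Lemma zone_lt i j : (i < j)%N -> zone i + N <= zone j.
Proof.
move=> ij; rewrite /zone -[X in _ + X]mul1r -mulrDl natr1.
by apply: ler_wpM2r; [exact: ltW N_gt0|rewrite ler_nat].
Qed.

Lemma in_zone_arc i x a : (i < 4)%N -> 0 <= a -> in_zone i x a -> arc X a x.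
Proof.
have Nb := N_bounds.
move=> i4 a0 [Lx x0 x1]; split=> //.
  by have : 0 <= zone i by [rewrite mulr_ge0 // ltW]; lra.
by have := zone_lt i4; rewrite /zone in x1 *; lra.
Qed.

Lemma in_zone_apart i j x y a : i != j -> in_zone i x a -> in_zone j y a -> apart a x y.
Proof.
rewrite neq_ltn => ij [_ x0 x1] [_ y0 y1]; rewrite /apart.
by case/orP: ij => /zone_lt; lra.
Qed.

Lemma in_zone_triad i j k x y z a : L a -> 0 <= a ->
  (i < 4)%N -> (j < 4)%N -> (k < 4)%N -> i != j -> j != k -> i != k ->
  in_zone i x a -> in_zone j y a -> in_zone k z a -> triad x y z a.
Proof.
have Nb := N_bounds.
move=> La a0 i4 j4 k4 ij jk ik zx zy zz; split=> //.
  by split; [exact: in_zone_arc zx|exact: in_zone_arc zy|exact: in_zone_arc zz].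
by split; [exact: in_zone_apart zx zy|exact: in_zone_apart zy zz|exact: in_zone_apart zx zz].
Qed.

Lemma zone_shift_fix i j s g y a : (i < 3)%N -> (j < 3)%N -> i != j -> 0 <= a ->
  zone_shift i s g -> in_zone j y a -> moves g y y a.
Proof.
have Nb := N_bounds.
move=> i3 j3 ij a0 [_ _ gS] zy; have [_ y0 y1] := in_zone_arc (ltnW j3) a0 zy.
apply: (moves_id gS) => // p; rewrite /in_arc; case: zy => _ yj yjN.
have := zone_lt j3; move: ij; rewrite neq_ltn => /orP[] /zone_lt; lra.
Qed.

Lemma shift_step i j k s x y z a : L a -> 0 <= a ->
  (i < 3)%N -> (j < 3)%N -> (k < 3)%N -> i != j -> j != k -> i != k -> s \in S ->
  in_zone i x (a + s) -> in_zone j y a -> in_zone k z a ->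
  P (cyc x y z a) <-> P (cyc (x + s) y z a).
Proof.
have Nb := N_bounds.
move=> La a0 i3 j3 k3 ij jk ik sS [Lx xi xiN] zy zz.
have [Ls /andP[s0 sN]] := S_small sS; have [g Pg gP] := P_shift i3 sS.
have [Eg gi _] := gP.
have zx : in_zone i x a by split=> //; lra.
have zxs : in_zone i (x + s) a by split; auto with lengths; lra.
have t1 : triad x y z a by apply: (in_zone_triad (i := i) (j := j) (k := k)) => //; exact: ltnW.
have t2 : triad (x + s) y z a by apply: (in_zone_triad (i := i) (j := j) (k := k)) => //; exact: ltnW.
have gx : moves g x (x + s) a.
  rewrite (_ : x + s = zone i + s + (x - zone i)); last by lra.
  by rewrite -{1}(subrKC (zone i) x); apply: movesS gi _ _; lra.
have gy := zone_shift_fix i3 j3 ij a0 gP zy; have gz := zone_shift_fix i3 k3 ik a0 gP zz.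
have e1 : (cyc (x + s) y z a ^ g)%g = cyc x y z a by exact: cycJ.
split=> Pc; last by rewrite -e1; exact: subgroupJ.
rewrite (_ : cyc _ _ _ _ = (cyc x y z a ^ g^-1)%g); last by rewrite -e1 conjgK.
exact: subgroupJ P_subgroup Pc (subgroupV P_subgroup Pg).
Qed.

Lemma cyc_subgroup_rot x y z a : triad x y z a -> P (cyc x y z a) <-> P (cyc y z x a).
Proof. by move=> t; rewrite (cyc_rot t). Qed.

Lemma zone_start i a : a <= N -> in_zone i (zone i) a.
Proof. by move=> aN; split; auto with lengths; lra. Qed.

Lemma shift_steps s a : s \in S -> L a -> 0 <= a -> a + s <= N ->
  P (cyc (zone 0) (zone 1) (zone 2) a) <->
  P (cyc (zone 0 + s) (zone 1 + s) (zone 2 + s) a).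
Proof.
have Nb := N_bounds.
move=> sS La a0 asN; have [Ls /andP[s0 sN]] := S_small sS.
have z i : in_zone i (zone i) a by apply: zone_start; lra.
have z' i : in_zone i (zone i + s) a by split; auto with lengths; lra.
have zs i : in_zone i (zone i) (a + s) by exact: zone_start.
have tri := in_zone_triad La a0.
rewrite (@shift_step 0 1 2 s) // cyc_subgroup_rot; last exact: (tri 0 1 2)%N.
rewrite (@shift_step 1 2 0 s) // cyc_subgroup_rot; last exact: (tri 1 2 0)%N.
rewrite (@shift_step 2 0 1 s) // cyc_subgroup_rot //; exact: (tri 2 0 1)%N.
Qed.

(** The lengths [a] that satisfy the conclusion are reached by a walk: to add [s]
  to [a], multiply the cycle of length [s] by the shift of the cycle of length
  [a]. *)
Lemma zone_cycles_start a : L a -> 0 <= a <= N / 2 ->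
  P (cyc (zone 0) (zone 1) (zone 2) a).
Proof.
have Nb := N_bounds.
move=> La aN; have [ws wsS aE] := S_gen La.
have z b i : b <= N / 2 -> in_zone i (zone i) b by move=> ?; apply: zone_start; lra.
have tri b : L b -> 0 <= b <= N / 2 -> triad (zone 0) (zone 1) (zone 2) b.
  move=> Lb /andP[b0 bN].
  by apply: (@in_zone_triad 0 1 2 _ _ _ b) => //; apply: z.
pose C b := L b /\ P (cyc (zone 0) (zone 1) (zone 2) b).
suff [] : C a by [].
rewrite aE -[\sum_(_ <- _) _]add0r; apply: (walk (S := S) (c := N / 4) (M := N / 2)).
- by lra.
- exact: wsS.
- by move=> s /S_small[_ sN]; rewrite ger0_norm; lra.
- move=> b w bN bwN /orP[wS|wS] [Lb Pb].
    have [Lw w0] := S_small wS; split; first exact: lengthsD.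
    rewrite addrC cycD //; [|by apply: tri; [exact: lengthsD|lra]|lra|lra].
    by apply: (subgroupM P_subgroup (P_base wS)); apply/shift_steps => //; lra.
  have [Ls s0] := S_small wS; set s := - w in wS Ls s0 *.
  have -> : b + w = b - s by rewrite opprK.
  have Lbs : L (b - s) by exact: lengthsB.
  have bs : 0 <= b - s <= N / 2 by rewrite opprK.
  split=> //; apply/(shift_steps wS) => //; [lra|lra|].
  have tr : triad (zone 0) (zone 1) (zone 2) (s + (b - s)) by rewrite subrKC; exact: tri.
  move: Pb; rewrite -{1}(subrKC s b) (cycD tr) //; try lra.
  by move=> /(subgroupM P_subgroup (subgroupV P_subgroup (P_base wS))); rewrite mulKg.
- by lra.
- by rewrite add0r -aE.
- split; first exact: lengths0.
  rewrite cyc0 //; first exact: subgroup1.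
  by apply: tri; [exact: lengths0|lra].
Qed.

(** The positions of the arc in the zone [i] are reached by a walk whose steps are
  conjugations by the shifts of that zone. *)
Lemma zone_walk i j k y z a o : L a -> 0 <= a -> a <= N / 2 ->
  (i < 3)%N -> (j < 3)%N -> (k < 3)%N -> i != j -> j != k -> i != k ->
  in_zone j y a -> in_zone k z a -> L o -> 0 <= o <= N - a ->
  P (cyc (zone i) y z a) -> P (cyc (zone i + o) y z a).
Proof.
have Nb := N_bounds.
move=> La a0 aN i3 j3 k3 ij jk ik zy zz Lo oN P0; have [ws wsS oE] := S_gen Lo.
pose C b := L b /\ P (cyc (zone i + b) y z a).
suff [] : C o by [].
rewrite oE -[\sum_(_ <- _) _]add0r; apply: (walk (S := S) (c := N / 4) (M := N - a)).
- by lra.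
- exact: wsS.
- by move=> s /S_small[_ sN]; rewrite ger0_norm; lra.
- move=> b w bN bwN /orP[wS|wS] [Lb Pb].
    have [Lw w0] := S_small wS; split; first exact: lengthsD.
    rewrite addrA; apply/(@shift_step i j k w (zone i + b) y z a) => //.
    by split; auto with lengths; lra.
  have [Ls s0] := S_small wS; set s := - w in wS Ls s0 *.
  have -> : b + w = b - s by rewrite opprK.
  have bs : 0 <= b - s <= N - a by rewrite opprK.
  have Lbs : L (b - s) by exact: lengthsB.
  split=> //; apply/(@shift_step i j k s (zone i + (b - s)) y z a) => //.
    by split; auto with lengths; lra.
  by rewrite -addrA subrK.
- by lra.
- by rewrite add0r -oE.
- by rewrite /C addr0; split=> //; exact: lengths0.
Qed.

Lemma zone_cycles x y z a : L a -> 0 <= a -> a <= N / 2 ->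
  in_zone 0 x a -> in_zone 1 y a -> in_zone 2 z a -> P (cyc x y z a).
Proof.
have Nb := N_bounds.
move=> La a0 aN zx zy zz; have tri := in_zone_triad La a0.
have zs i : in_zone i (zone i) a by apply: zone_start; lra.
have off i u : in_zone i u a -> L (u - zone i) /\ 0 <= u - zone i <= N - a.
  by move=> [Lu u0 u1]; split; [apply: lengthsB (zone_lengths i)|lra].
have P0 : P (cyc (zone 0) (zone 1) (zone 2) a) by apply: zone_cycles_start => //; lra.
have P1 : P (cyc x (zone 1) (zone 2) a).
  have [Lo oN] := off _ _ zx; rewrite -(subrKC (zone 0) x).
  exact: (@zone_walk 0 1 2).
have P2 : P (cyc y (zone 2) x a).
  have [Lo oN] := off _ _ zy; rewrite -(subrKC (zone 1) y).
  apply: (@zone_walk 1 2 0) => //.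
  have T1 : triad x (zone 1) (zone 2) a by exact: (tri 0 1 2)%N.
  exact: (iffLR (cyc_subgroup_rot T1) P1).
have P3 : P (cyc z x y a).
  have [Lo oN] := off _ _ zz; rewrite -(subrKC (zone 2) z).
  apply: (@zone_walk 2 0 1) => //.
  have T2 : triad y (zone 2) x a by exact: (tri 1 2 0)%N.
  exact: (iffLR (cyc_subgroup_rot T2) P2).
have T3 : triad z x y a by exact: (tri 2 0 1)%N.
exact: (iffLR (cyc_subgroup_rot T3) P3).
Qed.

(** The starts of the zones 1 and 2 serve as hubs. *)
Lemma zone0_cycles x y z a : triad x y z a -> a <= N / 2 ->
  in_zone 0 x a -> in_zone 0 y a -> in_zone 0 z a -> P (cyc x y z a).
Proof.
have Nb := N_bounds.
move=> tr aN zx zy zz; have [[La a0] _ _] := tr.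
have z1 i : in_zone i (zone i) a by apply: zone_start; lra.
have hub u : in_zone 0 u a -> triad u (zone 1) (zone 2) a.
  by move=> zu; apply: (@in_zone_triad 0 1 2).
by apply: (@cyc_hub R X P x y z (zone 1) (zone 2) a) => //; auto;
  apply: zone_cycles.
Qed.

(** In a cycle with arcs in the zones 2, 0 and 1, replace the first arc by [k]
  with the help of an auxiliary arc [p] of the zone 1. *)
Lemma zone01_cycles x k k' a : L a -> 0 <= a -> 4 * a <= N ->
  apart a k k' -> in_zone 1 x a -> in_zone 0 k a -> in_zone 0 k' a ->
  P (cyc x k k' a).
Proof.
have Nb := N_bounds.
move=> La a0 aN kk' zx zk zk'.
have arcs i u : (i < 4)%N -> in_zone i u a -> arc X a u.
  by move=> i4; exact: in_zone_arc.
have ax := arcs 1%N _ isT zx; have ak := arcs 0%N _ isT zk; have ak' := arcs 0%N _ isT zk'.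
have [p zp xp] : exists2 p, in_zone 1 p a & apart a x p.
  case: zx => Lx x0 x1; have [h|h] := lerP (zone 1 + a) x.
    by exists (zone 1); [apply: zone_start|rewrite /apart]; lra.
  by exists (zone 1 + (N - a)); [split; auto with lengths|rewrite /apart]; lra.
have z2 : in_zone 2 (zone 2) a by apply: zone_start; lra.
have ap := arcs 1%N _ isT zp; have a2 := arcs 2%N _ isT z2.
have ap2 i u : (i < 2)%N -> in_zone i u a -> apart a (zone 2) u.
  by move=> i2 zu; apply: (in_zone_apart (i := 2) (j := i)) => //; case: i i2 zu => [|[]].
have ap01 u v : in_zone 1 u a -> in_zone 0 v a -> apart a u v.
  exact: (@in_zone_apart 1 0).
have t1 : triad (zone 2) k' x a.
  by split=> //; split; [exact: ap2 zk'|rewrite apartC; exact: ap01|exact: ap2 zx].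
have t2 : triad (zone 2) k p a.
  by split=> //; split; [exact: ap2 zk|rewrite apartC; exact: ap01|exact: ap2 zp].
have t3 : triad k k' x a.
  by split=> //; split; rewrite // apartC; exact: ap01.
have t4 : triad p k' x a.
  by split=> //; split; [exact: ap01|rewrite apartC; exact: ap01|rewrite apartC].
have P1 : P (cyc (zone 2) k' x a).
  rewrite (cyc_rot t1); apply: zone_cycles => //; lra.
have P2 : P (cyc (zone 2) k p a).
  rewrite (cyc_rot t2); apply: zone_cycles => //; lra.
rewrite (cyc_rot (triad_rot (triad_rot t3))).
rewrite -(cyc_replace t1 t2 t3 t4).
exact: subgroupJ P_subgroup P1 (subgroupV P_subgroup P2).
Qed.

(** Conjugation by an element of [P] that is trivial on the zone 0 extends the
  preceding lemma to arcs outside the zone 1. *)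
Lemma transport_cycles g x x' k k' a : L a -> 0 <= a -> 4 * a <= N ->
  apart a k k' -> in_zone 1 x a -> in_zone 0 k a -> in_zone 0 k' a -> P g -> E g ->
  moves g x' x a -> moves g (zone 0) (zone 0) N -> triad x' k k' a ->
  P (cyc x' k k' a).
Proof.
have Nb := N_bounds.
move=> La a0 aN kk' zx zk zk' Pg Eg gx g0 tr'.
have tr : triad x k k' a.
  split=> //; first by split; [exact: in_zone_arc zx|exact: in_zone_arc zk|exact: in_zone_arc zk'].
  by split=> //; [exact: in_zone_apart zx zk|exact: in_zone_apart zx zk'].
have fix0 u : in_zone 0 u a -> moves g u u a.
  move=> [_ u0 u1]; rewrite -(subrKC (zone 0) u); apply: movesS g0 _ _; lra.
rewrite -(cycJ Eg tr tr' gx (fix0 k zk) (fix0 k' zk')).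
exact: subgroupJ P_subgroup (zone01_cycles La a0 aN kk' zx zk zk') Pg.
Qed.

Definition in_some_zone x a :=
  (exists2 i, (i < 4)%N & in_zone i x a) \/ [/\ L x, 1 - N <= x & x + a <= 1].

(** The given cycles of zones bring the zones 2 and 3 and the interval
  [[1 - N, 1)] to the zone 1. *)
Lemma hub_cycles x k k' a : 4 * a <= N -> triad x k k' a -> in_some_zone x a ->
  in_zone 0 k a -> in_zone 0 k' a -> P (cyc x k k' a).
Proof.
have Nb := N_bounds.
move=> aN tr zx zk zk'; have [[La a0] [ax ak ak'] [xk kk' xk']] := tr.
have z0 : zone 0 = 0 by rewrite /zone mul0r.
have zE i : zone i = i%:R * N by [].
have z1 i : in_zone i (zone i) N by exact: zone_start.
have t123 : triad (zone 1) (zone 2) (zone 3) N.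
  by apply: (@in_zone_triad 1 2 3) => //; lra.
have fixes0 t u v : triad t u v N -> N <= t -> N <= u -> N <= v ->
    moves (cyc t u v N) (zone 0) (zone 0) N.
  move=> tuv tN uN vN; apply: cyc_fix => //; first by apply: (@in_zone_arc 0) => //; lra.
  - by rewrite /apart z0; lra.
  - by rewrite /apart z0; lra.
  - by rewrite /apart z0; lra.
have f123 := fixes0 _ _ _ t123; have Ee := cycE t123.
have tl : triad (1 - N) (zone 1) (zone 2) N.
  have [_ [_ a1 a2] [_ a12 _]] := triad_rot (triad_rot t123).
  split; first by split=> //; lra.
    by split=> //; split; auto with lengths; lra.
  by split=> //; rewrite /apart /zone; lra.
case: zx => [[[|[|[|[|//]]]] _ zx]|[Lx x0 x1]].
- by apply: zone0_cycles => //; lra.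
- exact: zone01_cycles.
- have sh : in_zone 1 (x - N) a.
    by case: zx => Lx; rewrite !zE; split; auto with lengths; rewrite ?zE; lra.
  apply: (transport_cycles (x := x - N) (g := (cyc (zone 1) (zone 2) (zone 3) N)^-1%g)) => //.
  + exact: subgroupV P_subgroup P_zones.
  + exact: ietsV.
  + have := cycVmoves t123 => m; case: zx => _ xz xz1.
    rewrite (_ : x - N = zone 1 + (x - zone 2)); last by rewrite !zE; lra.
    by rewrite -{1}(subrKC (zone 2) x); apply: movesS m _ _; lra.
  + apply: movesV => //; [apply: f123; rewrite zE|rewrite z0|rewrite z0]; lra.
- have sh : in_zone 1 (x - 2 * N) a.
    by case: zx => Lx; rewrite !zE; split; auto with lengths; rewrite ?zE; lra.
  apply: (transport_cycles (x := x - 2 * N) (g := cyc (zone 1) (zone 2) (zone 3) N)) => //.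
  + have [_ _ m _] := cyc_cycle t123; case: zx => _ xz xz1.
    rewrite (_ : x - 2 * N = zone 1 + (x - zone 3)); last by rewrite !zE; lra.
    by rewrite -{1}(subrKC (zone 3) x); apply: movesS m _ _; lra.
  + by apply: f123; rewrite zE; lra.
- have sh : in_zone 1 (x - (1 - N) + N) a.
    by split; rewrite ?zE; auto 6 with lengths; lra.
  apply: (transport_cycles (x := x - (1 - N) + N) (g := cyc (1 - N) (zone 1) (zone 2) N)) => //.
  + exact: cycE.
  + rewrite (_ : x - (1 - N) + N = zone 1 + (x - (1 - N))); last by rewrite zE; lra.
    by rewrite -{1}(subrKC (1 - N) x); apply: movesS (cyc_moves tl) _ _; lra.
  + by apply: (fixes0 _ _ _ tl); rewrite ?zE; lra.
Qed.

Lemma zone0_free (xs : seq R) a : L a -> 0 <= a -> (2 * size xs).+1%:R * a <= N ->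
  (forall x, x \in xs -> L x) ->
  exists2 k, in_zone 0 k a & forall x, x \in xs -> apart a x k.
Proof.
move=> La a0 aN Lxs; have [k [Lk k0 far]] := @room R X a xs 0 a0 La (lengths0 X) Lxs.
exists k => //; split=> //; rewrite /zone mul0r; first by lra.
by move: aN; rewrite -natr1 mulrDl; lra.
Qed.

(** Two arcs [k], [k'] of the zone 0 that are apart from the given ones serve as
  hubs. *)
Lemma some_zone_cycles x y z a : 9 * a <= N -> triad x y z a ->
  in_some_zone x a -> in_some_zone y a -> in_some_zone z a -> P (cyc x y z a).
Proof.
have Nb := N_bounds.
move=> aN tr zx zy zz.
have [[La a0] [ax ay az] _] := tr; have [Lx _ _] := ax; have [Ly _ _] := ay.
have [Lz _ _] := az.
have [|u|k zk far] := @zone0_free [:: x; y; z] a La a0.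
- by rewrite /=; lra.
- by rewrite !inE => /or3P[]/eqP->.
have [Lk _ _] := zk.
have [|u|k' zk' far'] := @zone0_free [:: x; y; z; k] a La a0.
- by rewrite /=; lra.
- by rewrite !inE => /or4P[]/eqP->.
have ak : arc X a k by exact: in_zone_arc zk.
have ak' : arc X a k' by exact: in_zone_arc zk'.
have hub u : u \in [:: x; y; z] -> arc X a u -> triad u k k' a.
  move=> uxyz au; split=> //; split; [exact: far|apply: far'|apply: far'].
    by rewrite !inE eqxx !orbT.
  by move: uxyz; rewrite !inE => /or3P[] /eqP->; rewrite eqxx ?orbT.
have [hx hy hz] : [/\ triad x k k' a, triad y k k' a & triad z k k' a].
  by split; apply: hub; rewrite // !inE eqxx ?orbT.
by apply: (cyc_hub P_subgroup hx hy hz tr); apply: hub_cycles => //; lra.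
Qed.

(** Cutting arcs at the endpoints of the zones puts each piece inside a zone. *)
Lemma alt_sub_zones : alt `<=` P.
Proof.
have Nb := N_bounds.
apply: alt_sub => // x y z l tr.
have [_ [[Lx x0 x1] [Ly y0 y1] [Lz z0 z1]] _] := tr.
pose B := [seq zone k - u | k <- iota 0 5, u <- [:: x; y; z]].
apply: (@cyc_cut R X P x y z l B (N / 9)) => //; first by lra.
  move=> b /allpairsP[[k u] /= [_ + ->]].
  by rewrite !inE => /or3P[] /eqP->; auto with lengths.
move=> o l' Lo Ll' o0 l'0 ol l'N Bo.
have tro := triadS tr Lo Ll' o0 (ltW l'0) ol.
have zoned u : u \in [:: x; y; z] -> arc X l' (u + o) -> in_some_zone (u + o) l'.
  move=> uxyz [Luo uo0 uo1].
  have cut k : (k < 5)%N -> (u + o + l' <= zone k) || (zone k <= u + o).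
    move=> k5; suff /Bo : zone k - u \in B by lra.
    by apply/allpairsP; exists (k, u); rewrite mem_iota.
  have z4 : 1 - N <= zone 4 by rewrite /zone; lra.
  have /orP[h4|h4] := cut 4%N isT; last by right; split=> //; lra.
  have step k : (k < 4)%N -> zone k.+1 = zone k + N.
    by move=> _; rewrite /zone -natr1 mulrDl mul1r.
  have /orP[h3|h3] := cut 3%N isT; last first.
    by left; exists 3%N => //; split=> //; rewrite -step.
  have /orP[h2|h2] := cut 2%N isT; last first.
    by left; exists 2%N => //; split=> //; rewrite -step.
  have /orP[h1|h1] := cut 1%N isT; last first.
    by left; exists 1%N => //; split=> //; rewrite -step.
  left; exists 0%N => //; split=> //; last by rewrite -step.
  by rewrite /zone mul0r.
have [_ [ax ay az] _] := tro.
apply: some_zone_cycles => //; first by lra.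
- by apply: zoned; rewrite // !inE eqxx.
- by apply: zoned; rewrite // !inE eqxx orbT.
- by apply: zoned; rewrite // !inE eqxx !orbT.
Qed.

End Zones.

(** * Finite generation *)

Section FiniteGeneration.
Variables (R : realType) (X : iet_group R).
Local Notation L := (lengths X).
Local Notation E := (@iets R X).
Local Notation triad := (triad X).
Local Notation cyc := (cyc X).
Local Notation alt := (@alt R X).
Implicit Types (f g r : X) (x y z l p a o s : R).

(** A rotation [r] of the zone [i] shifts the points of that zone, but need not be
  in [alt]; its quotient by its conjugate in the zone 3 is a commutator. *)
Lemma zone_shift_ex N i s : L N -> 1 / 5 < N < 1 / 4 -> (i < 3)%N -> L s -> 0 < s <= N / 4 ->
  exists2 g, alt g & @zone_shift R X N i s g.
Proof.
move=> LN Nb i3 Ls sN; have z_lens k : L (zone N k) by exact: lengthsMn.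
have zlt j : (j < 4)%N -> 0 <= zone N j /\ zone N j + N <= 1.
  move=> j4; split; first by rewrite mulr_ge0 //; lra.
  by have := zone_lt Nb j4; rewrite {2}/zone; lra.
have [zi0 ziN] := zlt i (ltnW i3); have [z30 z3N] := zlt 3%N isT.
have i_3 := zone_lt Nb i3.
have ai : arc X N (zone N i) by [].
have a3 : arc X N (zone N 3) by [].
have [|r Er rP] := @rotation_exists R X (zone N i) (N - s) s.
  by split; split; auto with lengths; lra.
have rS : supported r (in_arc (zone N i) N).
  have := rotates_supported rP; rewrite subrK; apply; lra.
have [||k Ek [kij kji kS]] := @swap_ex R X (zone N 3) (zone N i) N LN _ a3 ai.
- by lra.
- by rewrite /apart i_3 orbT.
have r3S : supported (r^-1 ^ k)%g (in_arc (zone N 3) N).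
  apply: supportedJ kij _ _ => //; first exact: ietsV.
  exact: supportedV.
exists [~ r^-1, k]%g.
  by rewrite -derived_alt; apply: sub_generated; exists r^-1%g; [exact: ietsV|exists k].
have Er3 : E (r^-1 ^ k)%g by apply: ietsJ => //; exact: ietsV.
rewrite commgEl invgK; split; first exact: ietsM.
  move=> o oN; rewrite evM ?r3S // /in_arc; try lra.
  by rewrite rP /rotation_fun; [case: ifPn; lra|lra].
apply: supportedM => //.
  by apply: supportedS rS _ => p _ ->.
by apply: supportedS r3S _ => p _ ->; rewrite orbT.
Qed.

Lemma alt_finitely_generated : lengths_generated X -> finitely_generated alt.
Proof.
move=> gen.
have [N LN Nb] : exists2 N, L N & 1 / 5 < N < 1 / 4.
  have [a La /andP[a0 a20]] := @lengths_dense _ X (1 / 20) ltac:(lra).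
  exists ((Num.floor (1 / 5 / a) + 1)%:~R * a).
    case: (_ + 1) => n; first exact: lengthsMn.
    by rewrite NegzE mulrNz mulNr; apply/lengthsN/lengthsMn.
  have := floor_itv (1 / 5 / a); rewrite ler_pdivlMr // ltr_pdivrMr // intrD1 mulrDl.
  by lra.
have [S S_small S_gen] := small_generators (ltac:(lra) : 0 < N / 4) gen.
pose sh i s : X := xget 1%g [set g | alt g /\ @zone_shift R X N i s g].
have shP i s : (i < 3)%N -> s \in S -> alt (sh i s) /\ @zone_shift R X N i s (sh i s).
  move=> i3 /S_small[Ls sN]; have [g ag gP] := zone_shift_ex LN Nb i3 Ls sN.
  by have := @xgetPex _ 1%g [set g : X | alt g /\ @zone_shift R X N i s g]; apply; exists g.
pose z := zone N.
pose shifts : seq X := [seq sh i s | i <- iota 0 3, s <- S].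
pose gens : seq X := shifts ++
  [seq cyc (z 0) (z 1) (z 2) s | s <- S] ++
  [:: cyc (z 1) (z 2) (z 3) N; cyc (1 - N) (z 1) (z 2) N].
have z_lens k : L (z k) by exact: lengthsMn.
have zE k : z k = k%:R * N by [].
exists [set` gens]; first exact: finite_seq.
apply/seteqP; split.
  apply: generated_sub; first exact: alt_subgroup.
  move=> g gg; have {gg} : g \in gens := gg.
  rewrite mem_cat => /orP[|/[!mem_cat]/orP[]].
  - case/allpairsP=> [[i s] /= [i3 sS ->]].
    have {}i3 : (i < 3)%N by move: i3; rewrite !inE => /or3P[] /eqP->.
    by have [] := shP i s i3 sS.
  - move=> /mapP[s /S_small[Ls sN] ->]; apply: cyc_alt; split; first by split=> //; lra.
      by split; split; rewrite ?zE; auto with lengths; lra.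
    by split; rewrite /apart !zE; lra.
  - rewrite !inE => /orP[] /eqP->; apply: cyc_alt; (split; first by split=> //; lra).
    + by split; split; rewrite ?zE; auto with lengths; lra.
    + by split; rewrite /apart !zE; lra.
    + by split; split; rewrite ?zE; auto with lengths; lra.
    + by split; rewrite /apart !zE; lra.
have in_gens g : g \in gens -> generated_subgroup [set` gens] g.
  by move=> gg; exact: sub_generated.
apply: (alt_sub_zones LN Nb S_small S_gen (generated_subgroupP _)).
- move=> i s i3 sS; have [_ gP] := shP i s i3 sS; exists (sh i s) => //.
  apply: in_gens; rewrite mem_cat; apply/orP; left.
  by apply/allpairsP; exists (i, s); rewrite mem_iota.
- move=> s sS; apply: in_gens; rewrite !mem_cat; apply/or3P/Or32.
  by apply/mapP; exists s.
- by apply: in_gens; rewrite !mem_cat !inE eqxx !orbT.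
- by apply: in_gens; rewrite !mem_cat !inE eqxx !orbT.
Qed.

End FiniteGeneration.

(** * Points and neighborhoods of the split interval *)

Section CircleFacts.
Variable R : realType.
Implicit Types x y : R.

Lemma to_circle0 : to_circle 0 = 0 :> circle R.
Proof. by apply: (addrI (to_circle 0)); rewrite -to_circleD !addr0. Qed.

Lemma to_circleN x : to_circle (- x) = - to_circle x :> circle R.
Proof. by apply: (addrI (to_circle x)); rewrite -to_circleD !subrr to_circle0. Qed.

Lemma int_small x : x \is a Num.int -> -1 < x < 1 -> x = 0.
Proof.
move=> /intrP[n ->]; rewrite -[-1]/((-1)%:~R) -[1]/(1%:~R) !ltr_int => n1.
by case: n n1 => [[|n]|n].
Qed.

Lemma rep_rightE x : 0 <= x < 1 -> rep_right (to_circle x) = x.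
Proof.
move=> x01; have r01 := rep_right_itv (to_circle x).
have /to_circleE/int_small := to_circle_rep_right (to_circle x); lra.
Qed.

Lemma rep_leftE x : 0 < x <= 1 -> rep_left (to_circle x) = x.
Proof.
move=> x01; have r01 := rep_left_itv (to_circle x).
have /to_circleE/int_small := to_circle_rep_left (to_circle x); lra.
Qed.

End CircleFacts.

Section SplitPoints.
Variables (R : realType) (H : set (circle R)).
Hypothesis H_subgroup : circle_subgroup H.
Hypothesis H_dense : forall e : R, 0 < e -> exists2 a, H (to_circle a) & 0 < a < e.

Local Notation T := (split_interval H).
Definition lift : set R := [set t | H (to_circle t)].
Local Notation L := lift.

Lemma H_add h k : H h -> H k -> H (h + k).
Proof.
move=> hh hk; have [H0 HB] := H_subgroup; rewrite -[k]opprK.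
by apply: (HB) => //; rewrite -[- k]sub0r; exact: HB.
Qed.

Lemma lift1 : L 1.
Proof.
rewrite /lift /= (_ : to_circle 1 = 0); first by case: H_subgroup.
by rewrite -to_circle0; apply/to_circleE; rewrite subr0 rpred1.
Qed.

Lemma liftB x y : L x -> L y -> L (x - y).
Proof.
by rewrite /lift /= to_circleD to_circleN => Hx Hy; exact: H_subgroup.2.
Qed.

Lemma liftN x : L x -> L (- x).
Proof. by move=> Lx; rewrite -sub0r -[0](subrr x) addrAC; do !apply: liftB. Qed.

Lemma lift0 : L 0.
Proof. by rewrite -(subrr 1); apply: liftB; exact: lift1. Qed.

Lemma liftD x y : L x -> L y -> L (x + y).
Proof. by move=> Lx Ly; rewrite -[y]opprK; apply: liftB => //; exact: liftN. Qed.

Lemma lift_between x y : x < y -> exists2 a, L a & x < a < y.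
Proof.
move=> xy; have [|u Lu /andP[u0 uxy]] := H_dense (_ : 0 < y - x); first by lra.
have Lz (z : int) : L (z%:~R * u).
  have Ln n : L (n%:R * u).
    by elim: n => [|n IH]; rewrite ?mul0r; [exact: lift0|rewrite -natr1 mulrDl mul1r; exact: liftD].
  by case: z => n; [exact: Ln|rewrite NegzE mulrNz mulNr; apply: liftN; exact: Ln].
exists ((Num.floor (x / u) + 1)%:~R * u) => //.
have := floor_itv (x / u); rewrite ler_pdivlMr // ltr_pdivrMr // intrD1 mulrDl.
by lra.
Qed.

Definition pos (p : T) : R := (val (p : split_interval_order H)).1.
Definition side (p : T) : bool := (val (p : split_interval_order H)).2.

Lemma split_valid (p : T) : split_pred H (pos p, side p).
Proof. by rewrite -surjective_pairing; exact: (valP (p : split_interval_order H)). Qed.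

Lemma split_eq (p q : T) : pos p = pos q -> side p = side q -> p = q.
Proof.
move=> pq spq; apply: (val_inj : injective (val : split_interval_order H -> _)).
by rewrite [LHS]surjective_pairing [RHS]surjective_pairing; congr pair.
Qed.

Definition split_point (p : R *l bool) (hp : split_pred H p) : T :=
  exist _ p hp : split_interval_order H.

(** To the right of the cut between the two copies of [a]. For [a] in the lift of
  [H], this is the order relation with the right copy of [a], but [a] need not
  belong to [[0, 1)] here. *)
Definition cut_ge (a : R) (p : R * bool) := (a < p.1) || ((a == p.1) && p.2).
Definition split_arc (a b : R) (p : T) :=
  cut_ge a (pos p, side p) && ~~ cut_ge b (pos p, side p).

Lemma cut_ge_le a b p : a <= b -> cut_ge b p -> cut_ge a p.
Proof.
rewrite /cut_ge => ab /orP[bp|/andP[/eqP <- ->]]; first by rewrite (le_lt_trans ab bp).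
by move: ab; rewrite le_eqVlt andbT => /orP[->|->]; rewrite ?orbT.
Qed.

Lemma cut_ge_shift a t x s : cut_ge (a + t) (x + t, s) = cut_ge a (x, s).
Proof. by rewrite /cut_ge /= ltrD2r (inj_eq (addIr t)). Qed.

Lemma cut_ge_max a b p : cut_ge (Num.max a b) p = cut_ge a p && cut_ge b p.
Proof.
have [ab|ba] := lerP a b.
  by case: (boolP (cut_ge b p)) => [/(cut_ge_le ab)->|]; rewrite ?andbF.
by case: (boolP (cut_ge a p)) => [/(cut_ge_le (ltW ba))->|].
Qed.

Lemma cut_ge_min a b p : cut_ge (Num.min a b) p = cut_ge a p || cut_ge b p.
Proof.
have [ab|ba] := lerP a b.
  by case: (boolP (cut_ge b p)) => [/(cut_ge_le ab)->|]; rewrite ?orbF.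
by case: (boolP (cut_ge a p)) => [/(cut_ge_le (ltW ba))->|].
Qed.

Lemma split_predE x s : split_pred H (x, s) <->
  [/\ s -> L x, cut_ge 0 (x, s) & ~~ cut_ge 1 (x, s)].
Proof.
rewrite /split_pred /cut_ge /lift /=; split.
  move=> /and4P[/andP[x0 x1] Hx e0 e1]; split.
  - by move=> st; move: Hx; rewrite st orbF => /asboolP.
  - by case: ltgtP x0 e0 => // [_ _|<- _]; rewrite ?eqxx.
  - by case: ltgtP x1 e1 => // -> _; rewrite eqxx.
move=> [Hx e0 e1]; apply/and4P; split.
- apply/andP; split; first by case/orP: e0 => [/ltW//|/andP[/eqP<- _]].
  by move: e1; rewrite negb_or -leNgt => /andP[].
- by case: s Hx {e0 e1} => [/(_ isT) ?|_]; rewrite ?orbT // orbF; apply/asboolP.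
- by apply/implyP => /eqP x0; move: e0; rewrite x0 ltxx eqxx.
- by apply/implyP => /eqP x1; move: e1; rewrite x1 ltxx eqxx.
Qed.

Lemma sideL p : side p -> L (pos p).
Proof. by move=> sp; have /split_predE[/(_ sp)] := split_valid p. Qed.

Lemma split_arc01 p : split_arc 0 1 p.
Proof. by rewrite /split_arc; have /split_predE[_ -> ->] := split_valid p. Qed.

Lemma split_arcI a b c d p :
  split_arc (Num.max a c) (Num.min b d) p = split_arc a b p && split_arc c d p.
Proof. by rewrite /split_arc cut_ge_max cut_ge_min negb_or andbACA. Qed.

Lemma split_arc_bounds a b p : split_arc a b p -> a <= pos p <= b /\ a < b.
Proof.
rewrite /split_arc /cut_ge /= negb_or -leNgt => /andP[ap /andP[pb bp]].
have ap' : a <= pos p by case/orP: ap => [/ltW//|/andP[/eqP-> _]].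
rewrite ap' pb; split=> //; rewrite lt_neqAle (le_trans ap' pb) andbT.
apply: contra bp => /eqP ab; rewrite ab in ap ap'.
have -> : b = pos p by apply/eqP; rewrite eq_le pb ap'.
by move: ap; rewrite ltNge pb /= => /andP[_ ->]; rewrite eqxx.
Qed.

Lemma lt_split (p q : T) : ((p : split_interval_order H) < q)%O =
  (pos p < pos q) || ((pos p == pos q) && (~~ side p && side q)).
Proof.
rewrite ltEsub Order.ProdLexiOrder.ltEprodlexi -/(pos p) -/(pos q) -/(side p) -/(side q).
by rewrite ltEbool; case: ltgtP => //= _; case: (side p); case: (side q).
Qed.

Lemma nbhs_cut_ge (p : T) a : L a -> cut_ge a (pos p, side p) ->
  nbhs p [set q : T | cut_ge a (pos q, side q)].
Proof.
move=> La ap; have [a0|a0] := lerP a 0.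
  apply: filterS filterT => q _; apply: (cut_ge_le a0).
  by have /split_predE[_ ->] := split_valid q.
have a1 : a <= 1.
  rewrite leNgt; apply/negP => a1.
  have /split_predE[_ _ /negP] := split_valid p; apply; exact: cut_ge_le (ltW a1) ap.
have va : split_pred H (a, false).
  by apply/split_predE; split; rewrite // /cut_ge /= ?a0 // -?leNgt andbF orbF -leNgt.
pose u := split_point va.
have uE (q : T) : ((u : split_interval_order H) < q)%O = cut_ge a (pos q, side q).
  by rewrite lt_split.
apply: filterS (open_nbhs_nbhs (conj (rray_open u) _)).
  by move=> q /=; rewrite in_itv /= andbT -uE.
by rewrite /= in_itv /= andbT; rewrite -uE in ap.
Qed.

Lemma nbhs_cut_lt (p : T) b : L b -> ~~ cut_ge b (pos p, side p) ->
  nbhs p [set q : T | ~~ cut_ge b (pos q, side q)].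
Proof.
move=> Lb pb; have [b1|b1] := lerP 1 b.
  apply: filterS filterT => q _.
  have /split_predE[_ _] := split_valid q; apply: contra; exact: cut_ge_le.
have b0 : 0 <= b.
  rewrite leNgt; apply/negP => b0; move/negP: pb; apply.
  by have /split_predE[_ + _] := split_valid p; apply: cut_ge_le; exact: ltW.
have vb : split_pred H (b, true).
  apply/split_predE; split; rewrite // /cut_ge /= ?andbT.
    by rewrite orbC -le_eqVlt.
  by rewrite orbC -le_eqVlt -ltNge.
pose u := split_point vb.
have uE (q : T) : ((q : split_interval_order H) < u)%O = ~~ cut_ge b (pos q, side q).
  rewrite lt_split /pos /side /= -/(pos q) -/(side q) andbT /cut_ge /=.
  by case: ltgtP; rewrite ?andbF ?orbF.
apply: filterS (open_nbhs_nbhs (conj (lray_open u) _)).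
  by move=> q /=; rewrite in_itv /= -uE.
by rewrite /= in_itv /=; rewrite -uE in pb.
Qed.

Lemma nbhs_split_arc (p : T) a b : L a -> L b -> split_arc a b p ->
  nbhs p [set q | split_arc a b q].
Proof.
move=> La Lb /andP[ap pb].
apply: filterS (filterI (nbhs_cut_ge La ap) (nbhs_cut_lt Lb pb)).
by move=> q [/= aq qb]; rewrite /split_arc aq.
Qed.

(** The arcs with endpoints in the lift of [H] form a basis of neighborhoods: by
  density such endpoints separate two points over distinct reals, and the two
  copies of a point are separated by the cut between them. *)
Lemma nbhs_arc (p : T) U : nbhs p U -> exists a b,
  [/\ L a, L b, split_arc a b p & forall q, split_arc a b q -> U q].
Proof.
rewrite itv_nbhsE => -[[lb rb] [oi pi] iU]; move: pi; rewrite itv_boundlr => /andP[lp pr].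
have [a [La ap aq]] : exists a, [/\ L a, cut_ge a (pos p, side p) &
    forall q : T, cut_ge a (pos q, side q) -> (lb <= BLeft q)%O].
  case: lb oi lp {iU} => [bl u|bl] oi lp; last first.
    have E := itv_open_ends_linfty oi; subst bl; exists 0; split=> //; first exact: lift0.
    by have /andP[] := split_arc01 p.
  have E := itv_open_ends_lside oi; subst bl; move: lp; rewrite bnd_simp lt_split.
  case/orP=> [up|/andP[/eqP up /andP[su sp]]].
    have [a La /andP[ua ap]] := lift_between up.
    exists a; split=> // [|q]; first by rewrite /cut_ge /= ap.
    rewrite bnd_simp lt_split /cut_ge /= => aq; apply/orP; left.
    by case/orP: aq => [|/andP[/eqP<-]//]; exact: lt_trans.
  exists (pos p); split; [exact: sideL|by rewrite /cut_ge /= eqxx sp orbT|].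
  by move=> q; rewrite bnd_simp lt_split /cut_ge /= up su.
have [b [Lb pb bq]] : exists b, [/\ L b, ~~ cut_ge b (pos p, side p) &
    forall q : T, ~~ cut_ge b (pos q, side q) -> (BRight q <= rb)%O].
  case: rb oi pr {iU} => [br v|br] oi pr; last first.
    have E := itv_open_ends_rinfty oi; subst br; exists 1; split=> //; first exact: lift1.
    by have /andP[] := split_arc01 p.
  have E := itv_open_ends_rside oi; subst br; move: pr; rewrite bnd_simp lt_split.
  case/orP=> [pv|/andP[/eqP pv /andP[sp sv]]].
    have [b Lb /andP[pb bv]] := lift_between pv.
    exists b; split=> // [|q]; rewrite /cut_ge /= negb_or -leNgt.
      by rewrite (ltW pb) (gt_eqF pb).
    move=> /andP[qb _]; rewrite bnd_simp lt_split; apply/orP; left.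
    exact: le_lt_trans bv.
  exists (pos v); split; first exact: sideL.
    by rewrite /cut_ge /= pv ltxx eqxx (negPf sp).
  move=> q; rewrite bnd_simp lt_split /cut_ge /= sv andbT.
  by case: ltgtP.
exists a, b; split=> //; first by rewrite /split_arc ap.
by move=> q /andP[/aq ql /bq qr]; apply: iU; rewrite /= itv_boundlr ql.
Qed.

End SplitPoints.

(** * Action on the right copies *)

#[local] Hint Resolve lift0 lift1 liftD liftB liftN : lift.

Section Exchanges.
Variables (R : realType) (H : set (circle R)).
Hypothesis H_subgroup : circle_subgroup H.
Hypothesis H_dense : forall e : R, 0 < e -> exists2 a, H (to_circle a) & 0 < a < e.

Local Notation T := (split_interval H).
Local Notation L := (lift H).
Implicit Types p q : T.

Definition shifts (t : R) (p q : T) := pos q = pos p + t /\ side q = side p.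

Lemma pos_split_copy c s : H c \/ s = false ->
  to_circle (pos (split_copy H c s)) = c /\ side (split_copy H c s) = s.
Proof.
rewrite /pos /side /= /copy_pair; case: s => /= [[Hc|//]|_].
  by rewrite asboolT //= to_circle_rep_right.
by rewrite to_circle_rep_left.
Qed.

Lemma translate_shift h p t : H h -> to_circle t = h ->
  split_pred H (pos p + t, side p) -> shifts t p (translate h p).
Proof.
move=> Hh th; rewrite split_predE // /cut_ge /= => -[Hs ge0 lt1].
have E : copy_pair H (to_circle (pos p + t)) (side p) = (pos p + t, side p).
  rewrite /copy_pair; case: (boolP (side p)) Hs ge0 lt1 => /= sp Hs ge0 lt1.
    rewrite asboolT /=; last exact: Hs.
    rewrite rep_rightE //; move: ge0 lt1; rewrite !andbT negb_or -leNgt orbC -le_eqVlt.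
    by move=> -> /andP[le1 ne1]; rewrite lt_neqAle le1 eq_sym ne1.
  rewrite rep_leftE //; move: ge0 lt1; rewrite !andbF !orbF -leNgt.
  by move=> -> ->.
have -> : translate h p = split_copy H (to_circle (pos p + t)) (side p).
  by rewrite /translate to_circleD th addrC.
by split; [exact: (congr1 fst E)|exact: (congr1 snd E)].
Qed.

Lemma shift_ex h p : H h ->
  exists t, [/\ to_circle t = h, L t & shifts t p (translate h p)].
Proof.
move=> Hh; exists (pos (translate h p) - pos p).
have [|e1 e2] := @pos_split_copy (h + to_circle (pos p)) (side p).
  case: (boolP (side p)) => [sp|]; [left|by right].
  by apply: H_add => //; exact: sideL.
have th : to_circle (pos (translate h p) - pos p) = h.
  by rewrite to_circleD to_circleN e1 addrK.
by split; [|rewrite /lift /= th|split; [rewrite subrKC|]].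
Qed.

Lemma cut_ge_subr t p a : cut_ge a (pos p + t, side p) = cut_ge (a - t) (pos p, side p).
Proof. by rewrite -{1}(subrK t a) cut_ge_shift. Qed.

(** The arc is chosen so that it does not wrap around the circle after the
  translation. *)
Lemma translate_local h p : H h -> exists a b t,
  [/\ [/\ L a, L b & L t], split_arc a b p
    & forall q, split_arc a b q -> shifts t q (translate h q)].
Proof.
move=> Hh; have [t [th Lt [pt st]]] := shift_ex p Hh.
exists (- t), (1 - t), t; split; first by split; auto with lift.
  have := split_arc01 (translate h p).
  by rewrite /split_arc pt st !cut_ge_subr sub0r.
move=> q /andP[q0 q1]; apply: translate_shift => //; apply/split_predE; split.
- by move=> sq; apply: liftD => //; exact: sideL.
- by rewrite cut_ge_subr sub0r.
- by rewrite cut_ge_subr.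
Qed.

Lemma translate_continuous h : H h -> continuous (translate h : T -> T).
Proof.
move=> Hh p U /(nbhs_arc H_subgroup H_dense)[c [d [Lc Ld pcd cdU]]].
have [a [b [t [[La Lb Lt] pab tq]]]] := translate_local p Hh.
have [pt st] := tq p pab.
have pcd' : split_arc (c - t) (d - t) p.
  by move: pcd; rewrite /split_arc pt st !cut_ge_subr.
have near1 := nbhs_split_arc La Lb pab.
have near2 := nbhs_split_arc (liftB H_subgroup Lc Lt) (liftB H_subgroup Ld Lt) pcd'.
apply: filterS (filterI near1 near2) => q [/= /tq[qt sq] qcd]; apply: cdU.
by move: qcd; rewrite /split_arc qt sq !cut_ge_subr.
Qed.

Definition locally_translation (F : T -> T) :=
  forall p, exists2 h, H h & \forall q \near p, F q = translate h q.

Lemma locally_translation_continuous F : locally_translation F -> continuous F.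
Proof.
move=> lF p U; have [h Hh nF] := lF p; rewrite (nbhs_singleton nF) => pU.
apply: filterS (filterI nF (translate_continuous Hh pU)) => q.
by case=> /= ->.
Qed.

Lemma IET_ex F F' : cancel F F' -> cancel F' F ->
  locally_translation F -> locally_translation F' ->
  exists2 f : homeo T, IET H f & f =1 F.
Proof.
move=> FK FK' lF lF'.
by exists (Homeo FK FK' (locally_translation_continuous lF)
                        (locally_translation_continuous lF')).
Qed.

Lemma translate_add h k p : H h -> H k -> translate h (translate k p) = translate (h + k) p.
Proof.
move=> Hh Hk; have [|e1 e2] := @pos_split_copy (k + to_circle (pos p)) (side p).
  case: (boolP (side p)) => [sp|]; [left|by right].
  by apply: H_add => //; exact: sideL.
by rewrite {1}/translate -/(pos _) -/(side _) e1 e2 addrA.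
Qed.

Lemma translate0 p : translate 0 p = p.
Proof.
have [] := @translate_shift 0 p 0 H_subgroup.1.
- exact: to_circle0.
- by rewrite addr0; exact: split_valid.
by rewrite addr0; exact: split_eq.
Qed.

Lemma IET_subgroup : is_subgroup (IET H).
Proof.
split=> [p|f g If Ig p].
  exists 0; first exact: H_subgroup.1.
  by apply: filterS filterT => q _; rewrite translate0.
pose p' := homeo_inv g p.
have [h Hh nf] := If p'; have [k Hk ng] := Ig p'.
exists (h - k); first exact: H_subgroup.2.
have HNk : H (- k) by rewrite -sub0r; apply: H_subgroup.2 => //; exact: H_subgroup.1.
have nV : nbhs p (homeo_inv g @^-1`
    ([set q | f q = translate h q] `&` [set q | g q = translate k q])).
  exact: homeo_inv_continuous (filterI nf ng).
apply: filterS nV => q /= [fq gq]; rewrite fq.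
rewrite -(translate_add _ Hh HNk); congr translate.
have gVq : g (homeo_inv g q) = q by exact: homeo_invK.
by rewrite -{2}gVq gq translate_add // addNr translate0.
Qed.

(** The point [x_{+0}], which is [x] itself if [x] is not doubled. *)
Definition right_copy (x : R) : T := split_copy H (to_circle x) true.
Definition IET_ev (f : homeo T) (x : R) : R := pos (f (right_copy x)).

Lemma right_copyE x : 0 <= x < 1 ->
  pos (right_copy x) = x /\ side (right_copy x) = `[< L x >].
Proof.
move=> x01; rewrite /pos /side /= /copy_pair /= /lift /=.
case: (asboolP (H (to_circle x))) => Hx /=; first by rewrite rep_rightE.
have [x0 x1] := andP x01; rewrite rep_leftE // (ltW x1) andbT lt_neqAle x0 andbT.
by apply/eqP => x00; apply: Hx; rewrite -x00; exact: (lift0 H_subgroup).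
Qed.

Lemma right_copyP q : side q = `[< L (pos q) >] ->
  0 <= pos q < 1 /\ q = right_copy (pos q).
Proof.
move=> sq; have q01 : 0 <= pos q < 1.
  have /split_predE[_] := split_valid q; rewrite /cut_ge /= => h0 h1.
  move: h1; rewrite negb_or -leNgt => /andP[h1 h2]; apply/andP; split.
    by case/orP: h0 => [/ltW//|/andP[/eqP<-]].
  rewrite lt_neqAle h1 andbT; apply: contra h2 => /eqP q1.
  by rewrite sq q1 eqxx /=; apply/asboolP; exact: lift1.
by have [rp rs] := right_copyE q01; split=> //; apply: split_eq; rewrite ?rp ?rs.
Qed.

Lemma IET_right_copy f x : IET H f -> 0 <= x < 1 ->
  [/\ 0 <= IET_ev f x < 1, f (right_copy x) = right_copy (IET_ev f x)
    & L (IET_ev f x) <-> L x].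
Proof.
move=> If x01; have [h Hh /nbhs_singleton fx] := If (right_copy x).
have [t [_ Lt [pt st]]] := shift_ex (right_copy x) Hh.
have [px sx] := right_copyE x01.
have evE : IET_ev f x = x + t by rewrite /IET_ev fx pt px.
have LE : L (IET_ev f x) <-> L x.
  rewrite evE; split=> [Lxt|Lx]; last exact: liftD.
  by rewrite -[x](addrK t); exact: liftB.
have [|? ?] := @right_copyP (f (right_copy x)); last by split.
rewrite -/(IET_ev f x) fx st sx; apply/asboolP/asboolP; tauto.
Qed.

Lemma split_arc_right_copy a b x : L a -> L b -> 0 <= x < 1 ->
  split_arc a b (right_copy x) = (a <= x < b).
Proof.
move=> La Lb x01; have [px sx] := right_copyE x01; rewrite /split_arc px sx.
have cut c : L c -> cut_ge c (x, `[< L x >]) = (c <= x).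
  move=> Lc; rewrite /cut_ge /=; case: ltgtP => //= cx; first by subst; exact: asboolT.
by rewrite !cut // -ltNge.
Qed.

(** Right copies are dense, and two elements of [H] that agree at a point are
  equal. *)
Lemma IET_ev_inj f g : IET H f -> IET H g ->
  (forall x, 0 <= x < 1 -> IET_ev f x = IET_ev g x) -> f = g.
Proof.
move=> If Ig fg; apply: homeoP => p.
have [h Hh fh] := If p; have [k Hk gk] := Ig p.
have [a [b [La Lb pab abU]]] := nbhs_arc H_subgroup H_dense (filterI fh gk).
pose m := Num.max a 0; have Lm : L m by rewrite /m; case: lerP => _; auto with lift.
have pm : split_arc m (Num.min b 1) p by rewrite split_arcI pab split_arc01.
have [/andP[mp pm'] mb] := split_arc_bounds pm.
have m01 : 0 <= m < 1.
  move: mb; rewrite /m lt_min => /andP[_ ->]; rewrite andbT.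
  by rewrite le_max lexx orbT.
have [|] := abU (right_copy m).
  have : split_arc m (Num.min b 1) (right_copy m).
    have Lb1 : L (Num.min b 1) by case: lerP => _ //; exact: lift1.
    by rewrite split_arc_right_copy // lexx.
  by rewrite split_arcI => /andP[].
have [_ fE _] := IET_right_copy If m01; have [_ gE _] := IET_right_copy Ig m01.
rewrite fE gE fg // => -> /= e; rewrite (nbhs_singleton fh) (nbhs_singleton gk).
suff -> : h = k by [].
have [t [th _ [pt _]]] := shift_ex (right_copy m) Hh.
have [s [sh _ [ps _]]] := shift_ex (right_copy m) Hk.
by rewrite -th -sh; congr to_circle; apply: (addrI (pos (right_copy m))); rewrite -pt -ps e.
Qed.

End Exchanges.

(** * Rotations and breakpoints in the group of the split interval *)

Section Rotate.
Variables (R : realType) (H : set (circle R)).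
Hypothesis H_subgroup : circle_subgroup H.
Hypothesis H_dense : forall e : R, 0 < e -> exists2 a, H (to_circle a) & 0 < a < e.

Local Notation T := (split_interval H).
Local Notation L := (lift H).
Implicit Types p q : T.

Lemma split_arc_shift c d t p : L t -> 0 <= c + t -> d + t <= 1 -> split_arc c d p ->
  shifts t p (translate (to_circle t) p).
Proof.
move=> Lt ct dt /andP[cp dp]; apply: translate_shift => //; apply/split_predE; split.
- by move=> sp; apply: liftD => //; exact: sideL.
- by apply: (cut_ge_le ct); rewrite cut_ge_shift.
- by apply: contra dp => /(cut_ge_le dt); rewrite cut_ge_shift.
Qed.

Lemma split_arc_split c m d p : c <= m -> m <= d ->
  split_arc c d p = split_arc c m p || split_arc m d p.
Proof.
move=> cm md; rewrite /split_arc; have := @cut_ge_le _ c m (pos p, side p) cm.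
have := @cut_ge_le _ m d (pos p, side p) md.
by do 3!case: (cut_ge _ _) => //=; move=> h1 h2; rewrite ?h1 ?h2 //; exfalso; auto.
Qed.

Lemma split_arc_shifts t p q c d : shifts t p q -> split_arc (c + t) (d + t) q = split_arc c d p.
Proof. by case=> qt sq; rewrite /split_arc qt sq !cut_ge_shift. Qed.

Definition rotate (x a b : R) p : T :=
  if split_arc x (x + a) p then translate (to_circle b) p
  else if split_arc (x + a) (x + a + b) p then translate (to_circle (- a)) p else p.

Lemma rotateK x a b : L x -> L a -> L b -> 0 <= x -> 0 <= a -> 0 <= b -> x + a + b <= 1 ->
  cancel (rotate x a b) (rotate x b a).
Proof.
move=> Lx La Lb x0 a0 b0 x1 p; rewrite {2}/rotate.
have LNa := liftN H_subgroup La; have LNb := liftN H_subgroup Lb.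
have [pA|npA] := boolP (split_arc x (x + a) p).
  have sh : shifts b p (translate (to_circle b) p) by apply: split_arc_shift pA => //; lra.
  have [qt sq] := sh; rewrite /rotate; case: ifPn => [/andP[_ /negP]|_].
    by case; rewrite qt sq cut_ge_shift; case/andP: pA.
  rewrite addrAC (split_arc_shifts x (x + a) sh) pA.
  by rewrite translate_add // -to_circleD addNr to_circle0 translate0.
have [pB|npB] := boolP (split_arc (x + a) (x + a + b) p).
  have sh : shifts (- a) p (translate (to_circle (- a)) p).
    by apply: split_arc_shift pB => //; lra.
  have := split_arc_shifts (x + a) (x + a + b) sh.
  rewrite addrK [_ + b - a]addrAC addrK pB /rotate => ->.
  by rewrite translate_add // -to_circleD subrr to_circle0 translate0.
have : split_arc x (x + a + b) p = false.
  by rewrite (@split_arc_split _ (x + a)) ?(negPf npA) ?(negPf npB) //; lra.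
rewrite addrAC (@split_arc_split _ (x + b)); [|lra|lra].
by rewrite /rotate => /negbT; rewrite negb_or => /andP[/negPf-> /negPf->].
Qed.

Lemma rotate_local x a b : L x -> L a -> L b -> 0 <= a -> 0 <= b ->
  locally_translation (rotate x a b).
Proof.
move=> Lx La Lb a0 b0 p.
have Lxa := liftD H_subgroup Lx La; have Lxab := liftD H_subgroup Lxa Lb.
have [pA|npA] := boolP (split_arc x (x + a) p).
  exists (to_circle b) => //; apply: filterS (nbhs_split_arc Lx Lxa pA) => q qA.
  by rewrite /rotate qA.
have [pB|npB] := boolP (split_arc (x + a) (x + a + b) p).
  exists (to_circle (- a)); first exact: liftN.
  apply: filterS (nbhs_split_arc Lxa Lxab pB) => q qB.
  by rewrite /rotate qB ifF //; move: qB; rewrite /split_arc => /andP[-> _]; rewrite andbF.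
exists 0; first exact: H_subgroup.1.
have outside q : ~~ split_arc x (x + a + b) q -> rotate x a b q = translate 0 q.
  rewrite (@split_arc_split _ (x + a)); [|lra|lra].
  by rewrite /rotate translate0 // negb_or => /andP[/negPf-> /negPf->].
have /nandP[xp|/negPn px] : ~~ split_arc x (x + a + b) p.
- by rewrite (@split_arc_split _ (x + a)) ?negb_or ?npA ?npB //; lra.
- apply: filterS (nbhs_cut_lt Lx xp) => q /= xq; apply: outside.
  by rewrite /split_arc (negPf xq).
- apply: filterS (nbhs_cut_ge Lxab px) => q /= qx; apply: outside.
  by rewrite /split_arc qx andbF.
Qed.

Lemma IET_rotation x a b : L x -> L a -> L b -> 0 <= x -> 0 <= a -> 0 <= b ->
  x + a + b <= 1 -> exists2 r, IET H r &
  forall u : R, 0 <= u < 1 -> IET_ev r u = rotation_fun x a b u.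
Proof.
move=> Lx La Lb x0 a0 b0 x1.
have [|r Er rE] := IET_ex H_subgroup H_dense (rotateK Lx La Lb x0 a0 b0 x1) _
   (rotate_local Lx La Lb a0 b0) (rotate_local Lx Lb La b0 a0).
  by apply: rotateK => //; lra.
exists r => // u p01; rewrite /IET_ev rE /rotate /rotation_fun.
have Lxa := liftD H_subgroup Lx La; have Lxab := liftD H_subgroup Lxa Lb.
have LNa := liftN H_subgroup La.
have pE := right_copyE H_subgroup p01.
rewrite -(split_arc_right_copy H_subgroup Lx Lxa p01).
rewrite -(split_arc_right_copy H_subgroup Lxa Lxab p01).
case: ifPn => [pA|_].
  have [-> _] : shifts b (right_copy H u) (translate (to_circle b) (right_copy H u)).
    by apply: split_arc_shift pA => //; lra.
  by rewrite pE.1.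
case: ifPn => [pB|_]; last by rewrite pE.1.
have [-> _] : shifts (- a) (right_copy H u) (translate (to_circle (- a)) (right_copy H u)).
  by apply: split_arc_shift pB => //; lra.
by rewrite pE.1.
Qed.

Lemma IET_ev1 (x : R) : 0 <= x < 1 -> IET_ev (1%g : homeo T) x = x.
Proof. by move=> x01; have [] := right_copyE H_subgroup x01. Qed.

Lemma IET_evM (f g : homeo T) (x : R) : IET H f -> IET H g -> 0 <= x < 1 ->
  IET_ev (f * g)%g x = IET_ev f (IET_ev g x).
Proof.
move=> _ Ig x01; have [_ gx _] := IET_right_copy H_subgroup Ig x01.
by rewrite {2}/IET_ev -gx.
Qed.

Lemma IET_ev_unit (f : homeo T) (x : R) : IET H f -> 0 <= x < 1 -> 0 <= IET_ev f x < 1.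
Proof. by move=> If x01; have [] := IET_right_copy H_subgroup If x01. Qed.

Lemma IET_ev_lens (f : homeo T) (x : R) : IET H f -> 0 <= x < 1 -> L x -> L (IET_ev f x).
Proof. by move=> If x01 Lx; have [_ _ ->] := IET_right_copy H_subgroup If x01. Qed.

(** An element acts as some [h] in [H] on a neighborhood, and [h] acts as a
  translation of the line on a smaller one. *)
Lemma IET_local f p : IET H f -> exists a b t,
  [/\ [/\ L a, L b & 0 <= a], split_arc a b p
    & forall x, a <= x < b -> 0 <= x < 1 -> IET_ev f x = x + t].
Proof.
move=> If; have [h Hh fh] := If p.
have [a [b [La Lb pab abU]]] := nbhs_arc H_subgroup H_dense fh.
have [c [d [t [[Lc Ld Lt] pcd cdt]]]] := translate_local H_subgroup p Hh.
have Lm : L (Num.max (Num.max a c) 0).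
  by case: lerP => _; [exact: lift0|case: lerP].
have Ln : L (Num.min (Num.min b d) 1).
  by case: lerP => _; [case: lerP|exact: lift1].
exists (Num.max (Num.max a c) 0), (Num.min (Num.min b d) 1), t; split.
- by split=> //; rewrite le_max lexx orbT.
- by rewrite !split_arcI pab pcd split_arc01.
move=> x xmn x01; have := split_arc_right_copy H_subgroup Lm Ln x01.
rewrite xmn !split_arcI => /andP[/andP[/abU/= fx /cdt[cx _]] _].
by rewrite /IET_ev fx cx; have [->] := right_copyE H_subgroup x01.
Qed.

(** This is the compactness of the split interval, in the form of an induction
  along the real line: the supremum [e] of the numbers such that finitely many
  breakpoints suffice on [[0, e]] belongs to the lift of [H], as the two copies
  of a point have separate neighborhoods, and then it is 1. *)
Lemma IET_breakpoints f : IET H f -> exists2 B : seq R, forall b, b \in B -> L b &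
  forall a b, L a -> L b -> 0 <= a -> a < b -> b <= 1 ->
    (forall t, t \in B -> ~~ (a < t < b)) ->
    exists c, forall u : R, a <= u < b -> IET_ev f u = u + c.
Proof.
move=> If.
pose good (e : R) (B : seq R) := (forall b, b \in B -> L b) /\
  forall a b, L a -> L b -> 0 <= a -> a < b -> b <= e ->
    (forall t, t \in B -> ~~ (a < t < b)) ->
    exists c, forall u : R, a <= u < b -> IET_ev f u = u + c.
pose A : set R := [set e | 0 <= e <= 1 /\ exists B, good e B].
suff [_ [B [LB gB]]] : A 1 by exists B.
have good_le e e' B : e' <= e -> good e B -> good e' B.
  by move=> ee [LB gB]; split=> // a b La Lb a0 ab be; apply: gB => //; exact: le_trans ee.
have A0 : A 0.
  by split; [rewrite lexx ler01|exists [::]; split=> // a b _ _ a0 ab b0; exfalso; lra].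
have supA : has_sup A by split; [exists 0|exists 1 => e [/andP[]]].
have A_sup e : A e -> e <= sup A by move=> Ae; exact: ub_le_sup supA.2 _ Ae.
have s0 : 0 <= sup A by exact: A_sup.
have s1 : sup A <= 1 by apply: ge_sup supA.1 _ => e [/andP[]].
(* an arc [a, b) on which f is a translation extends goodness from a to b *)
have extend a b t B : L a -> L b -> a < b <= 1 ->
    (forall x, a <= x < b -> 0 <= x < 1 -> IET_ev f x = x + t) ->
    0 <= a -> good a B -> A b.
  move=> La Lb /andP[ab b1] ft a0 [LB gB]; split; first by lra.
  exists (a :: B); split=> [c|c d Lc Ld c0 cd db Bcd].
    by rewrite inE => /orP[/eqP->//|]; exact: LB.
  have [da|ad] := lerP d a.
    by apply: gB => // u uB; apply: Bcd; rewrite inE uB orbT.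
  have ac : a <= c by have := Bcd a; rewrite inE eqxx => /(_ isT); lra.
  by exists t => u ucd; apply: ft; lra.
have As : A (sup A) /\ (sup A = 0 \/ L (sup A)).
  have [s00|spos] : sup A = 0 \/ 0 < sup A.
    by move: s0; rewrite le_eqVlt => /orP[/eqP|]; auto.
    by rewrite s00; split=> //; left.
  have vp : split_pred H (sup A, false).
    apply/split_predE; split; rewrite // /cut_ge /= ?spos //.
    by rewrite andbF orbF -leNgt.
  have [a [b [t [[La Lb a0] pab ft]]]] := IET_local (split_point vp) If.
  move: pab; rewrite /split_arc /cut_ge /= !andbF !orbF -leNgt => /andP[as_ sb].
  have {}as_ : a < sup A := as_; have {}sb : sup A <= b := sb.
  have [e Ae ae] := sup_gt supA.1 as_.
  have [_ [B gB]] := Ae.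
  have gaB : good a B by apply: good_le gB; exact: ltW.
  have Lb1 : L (Num.min b 1) by case: lerP => _ //; exact: lift1.
  have Ab : A (Num.min b 1).
    apply: (extend a _ t B) => //; first by rewrite lt_min ge_min lexx orbT; lra.
    by move=> x; rewrite lt_min => xab; apply: ft; lra.
  have sE : sup A = Num.min b 1.
    by apply/eqP; rewrite eq_le A_sup // andbT le_min sb s1.
  by rewrite sE; split=> //; right.
have [[_ [B gB]] Ls] := As.
have {}Ls : L (sup A) by case: Ls => // ->; exact: lift0.
have [sE|slt] : sup A = 1 \/ sup A < 1.
  by move: s1; rewrite le_eqVlt => /orP[/eqP|]; auto.
  by rewrite -sE; case: As.
have vp : split_pred H (sup A, true).
  apply/split_predE; split; rewrite // /cut_ge /= andbT.
    by rewrite orbC -le_eqVlt.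
  by rewrite orbC -le_eqVlt -ltNge.
have [a [b [t [[La Lb a0] pab ft]]]] := IET_local (split_point vp) If.
move: pab; rewrite /split_arc /cut_ge /= !andbT ![_ || (_ == _)]orbC -!le_eqVlt -ltNge.
move=> /andP[].
rewrite -[pos _]/(sup A) => as_ sb.
have Lb1 : L (Num.min b 1) by case: lerP => _ //; exact: lift1.
have Ab : A (Num.min b 1).
  apply: (extend (sup A) _ t B) => //; first by rewrite lt_min sb slt ge_min lexx orbT.
  by move=> x; rewrite lt_min => xsb; apply: ft; lra.
by have := A_sup _ Ab; rewrite leNgt lt_min sb slt.
Qed.

Definition IET_model : iet_group R := @IETGroup R (homeo T) (IET H) L (@IET_ev R H)
  (IET_subgroup H_subgroup) (lift1 H_subgroup) (liftB H_subgroup) H_dense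
  IET_ev1 IET_evM IET_ev_unit IET_ev_lens (IET_ev_inj H_subgroup H_dense)
  IET_rotation IET_breakpoints.

End Rotate.

(** * Density and generators of the group of lengths *)

(** Otherwise the subgroup would have a least positive element, of which 1 and
  [alpha] would be integer multiples. *)
Lemma irrational_dense (R : realType) (A : set R) (alpha : R) :
  A 1 -> (forall a b, A a -> A b -> A (a - b)) -> A alpha -> irrational alpha ->
  forall e, 0 < e -> exists2 a, A a & 0 < a < e.
Proof.
move=> A1 AB Aalpha irr e e0; apply: contrapT => none.
have A0 : A 0 by rewrite -(subrr 1); exact: AB.
have AN a : A a -> A (- a) by move=> Aa; rewrite -sub0r; exact: AB.
have AD a b : A a -> A b -> A (a + b).
  by move=> Aa Ab; rewrite -[b]opprK; exact: AB (AN _ Ab).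
pose P : set R := [set a | A a /\ 0 < a].
have infP : has_inf P.
  by split; [exists 1|exists 0 => a [_ /ltW]].
have [l [Al l0] lg] := inf_adherent e0 infP.
have lmin a : A a -> 0 < a -> l <= a.
  move=> Aa a0; rewrite leNgt; apply/negP => al; apply: none.
  exists (l - a); first exact: AB.
  have : inf P <= a by apply: ge_inf; [exact: infP.2|].
  by lra.
have Al_mul (z : int) : A (z%:~R * l).
  have An n : A (n%:R * l).
    by elim: n => [|n IH]; rewrite ?mul0r // -natr1 mulrDl mul1r; exact: AD.
  by case: z => n; [exact: An|rewrite NegzE mulrNz mulNr; apply: AN; exact: An].
have multiple a : A a -> exists z : int, a = z%:~R * l.
  move=> Aa; exists (Num.floor (a / l)); apply/eqP; rewrite -subr_eq0; apply/negPn/negP => ne.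
  have := floor_itv (a / l); rewrite ler_pdivlMr // ltr_pdivrMr // intrD1 mulrDl mul1r.
  move=> /andP[lo hi]; have := lmin _ (AB _ _ Aa (Al_mul (Num.floor (a / l)))).
  by rewrite subr_gt0 lt_neqAle lo andbT eq_sym -subr_eq0 ne => /(_ isT); lra.
have [n n1] := multiple 1 A1; have [m mE] := multiple alpha Aalpha.
have n0 : n%:~R != 0 :> R.
  by apply/eqP => n00; move: n1; rewrite n00 mul0r => /eqP; rewrite oner_eq0.
apply: irr; exists (m%:~R / n%:~R) => //.
rewrite fmorph_div /= !ratr_int mE; apply: (mulIf n0).
by rewrite mulfVK // -mulrA [l * _]mulrC -n1 mulr1.
Qed.

Section Generated.
Variables (R : realType) (d : nat) (alpha : 'I_d -> R).
Local Notation H := (translation_group alpha).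

Lemma translation_group_subgroup : circle_subgroup H.
Proof.
split=> [K [[]//]|x y Hx Hy K [sK gK]].
by apply: sK.2; [apply: Hx|apply: Hy].
Qed.

Lemma lift_alpha i : lift H (alpha i).
Proof. by move=> K [_]; apply; exists i. Qed.

(** The classes all of whose representatives are in [A] form a subgroup of the
  circle, as [A] contains the integers. *)
Lemma lift_ind (A : set R) : A 0 -> (forall a b, A a -> A b -> A (a - b)) ->
  A 1 -> (forall i, A (alpha i)) -> lift H `<=` A.
Proof.
move=> A0 AB A1 Aalpha.
have AN a : A a -> A (- a) by move=> Aa; rewrite -sub0r; exact: AB.
have AD a b : A a -> A b -> A (a + b).
  by move=> Aa Ab; rewrite -[b]opprK; exact: AB (AN _ Ab).
have Aint x : x \is a Num.int -> A x.
  move=> /intrP[z ->].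
  have An n : A n%:R by elim: n => [|n IH] //; rewrite -natr1; exact: AD.
  by case: z => n; [exact: An|rewrite NegzE mulrNz; apply: AN; exact: An].
pose K : set (circle R) := [set c | forall t, to_circle t = c -> A t].
have KP t s : A s -> to_circle t = to_circle s -> A t.
  by move=> As /to_circleE/Aint Ats; rewrite -(subrK s t); exact: AD.
move=> t /(_ K); apply=> //; split.
  split=> [u|c c' Kc Kc' u uE]; first by rewrite -to_circle0; exact: KP.
  have As : A (rep_right c') by apply: Kc'; exact: to_circle_rep_right.
  rewrite -(addrK (rep_right c') u); apply: AB => //; apply: Kc.
  by rewrite to_circleD uE to_circle_rep_right subrK.
by move=> _ [i _ <-] u; exact: KP.
Qed.

End Generated.

Theorem theorem12 (R : realType) (d : nat) (alpha : 'I_d -> R)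
    (d_ge1 : (1 <= d)%N)
    (alpha_irrational : forall i : 'I_d, irrational (alpha i))
    (H_free : exists f : {additive 'rV[int]_d -> circle R},
        set_bij [set: 'rV[int]_d] (translation_group alpha) f) :
  simple_group (derived_subgroup (IET (translation_group alpha))) /\
  finitely_generated (derived_subgroup (IET (translation_group alpha))).
Proof.
have sH := translation_group_subgroup alpha.
pose i0 : 'I_d := Ordinal d_ge1.
have dense := irrational_dense (lift1 sH) (liftB sH) (lift_alpha i0) (alpha_irrational i0).
pose X := IET_model sH dense.
rewrite -[IET _]/(@iets R X) (derived_alt X); split; first exact: (alt_simple X).
apply: (@alt_finitely_generated R X); exists (1 :: [seq alpha i | i <- enum 'I_d]).
  by move=> a; rewrite inE => /orP[/eqP->|/mapP[i _ ->]]; [exact: lift1|exact: lift_alpha].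
move=> A A0 AB As; apply: lift_ind => // [|i]; apply: As; first by rewrite inE eqxx.
by rewrite inE map_f ?orbT // mem_enum.
Qed.
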